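(* Let $(X,\mathcal{T},(I_i)_{i\in\mathbb{N}})$ be a computable topological space, let $n\in\mathbb{N}\setminus\{0\}$ and let $S$ be a semicomputable set in $(X,\mathcal{T},(I_i))$ such that $S$, as a subspace of $(X,\mathcal{T})$, is an $n$-manifold with boundary and its boundary $\partial S$ is a semicomputable set in $(X,\mathcal{T},(I_i))$. Then $S$ is a computable set in $(X,\mathcal{T},(I_i))$.
   Context: Fix a function $j\mapsto[j]$ from $\mathbb{N}$ onto the set of all nonempty finite subsets of $\mathbb{N}$ which is computably finite valued: the set $\{(j,i)\in\mathbb{N}^2 : i\in[j]\}$ is computable and there is a computable $\varphi:\mathbb{N}\to\mathbb{N}$ with $[j]\subseteq\{0,\dots,\varphi(j)\}$ for all $j$. A computable topological space is a triple $(X,\mathcal{T},(I_i)_{i\in\mathbb{N}})$ where $(X,\mathcal{T})$ is a topological space, $\{I_i : i\in\mathbb{N}\}\subseteq\mathcal{T}$ is a basis for $\mathcal{T}$, and there exist computably enumerable (c.e.) sets $\mathcal{C},\mathcal{D}\subseteq\mathbb{N}^2$ such that: (1) if $(i,j)\in\mathcal{D}$ then $I_i\cap I_j=\emptyset$; (2) if $(i,j)\in\mathcal{C}$ then $I_i\subseteq I_j$; (3) if $x,y\in X$, $x\neq y$, there exist $i,j$ with $x\in I_i$, $y\in I_j$, $(i,j)\in\mathcal{D}$; (4) if $x\in I_i\cap I_j$, there exists $k$ with $x\in I_k$, $(k,i)\in\mathcal{C}$, $(k,j)\in\mathcal{C}$. For $j\in\mathbb{N}$ let $J_j=\bigcup_{i\in[j]}I_i$.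 A compact set $S$ is semicomputable if $\{j\in\mathbb{N}: S\subseteq J_j\}$ is c.e.; a closed set $S$ is c.e. if $\{i\in\mathbb{N}: I_i\cap S\neq\emptyset\}$ is c.e.; a compact set is computable if it is both c.e. and semicomputable. Let $\mathbb{H}^n=\{(x_1,\dots,x_n)\in\mathbb{R}^n: x_n\ge 0\}$ and $\mathrm{Bd}\,\mathbb{H}^n=\{x\in\mathbb{R}^n: x_n=0\}$. A topological space $M$ is an $n$-manifold with boundary if each $x\in M$ has a neighborhood $N$ in $M$ such that either $N$ is homeomorphic to $\mathbb{R}^n$, or there is a homeomorphism $f:\mathbb{H}^n\to N$ with $x\in f(\mathrm{Bd}\,\mathbb{H}^n)$; $\partial M$ is the set of points $x$ having a neighborhood of the second kind. *)

(* Defs.v *)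
From mathcomp Require Import all_boot all_order all_algebra.
From mathcomp Require Import all_classical all_reals all_analysis.
Import Order.TTheory GRing.Theory Num.Theory.
Import numFieldNormedType.Exports.

Set Implicit Arguments.
Unset Strict Implicit.
Unset Printing Implicit Defensive.

Local Open Scope classical_set_scope.

(* The total computable functions N^k -> N, as the least class containing the
   basic functions and closed under composition, primitive recursion and
   minimization of regular functions.  Regularity (the minimum always exists)
   is expressed in [mu_min] by giving the function [h] of minima.  Composition
   with m = 0 turns the 0-ary constant into the k-ary one. *)
Inductive mu_recursive : forall k : nat, (k.-tuple nat -> nat) -> Prop :=
| mu_zero : @mu_recursive 0 (fun=> 0)
| mu_succ : @mu_recursive 1 (fun v => (thead v).+1)
| mu_proj k (i : 'I_k) : @mu_recursive k (fun v => tnth v i)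
| mu_comp m k (f : m.-tuple nat -> nat) (g : 'I_m -> k.-tuple nat -> nat) :
    mu_recursive f -> (forall i, mu_recursive (g i)) ->
    @mu_recursive k (fun v => f [tuple g i v | i < m])
| mu_prim k (f : k.-tuple nat -> nat) (g : k.+2.-tuple nat -> nat)
    (h : k.+1.-tuple nat -> nat) :
    mu_recursive f -> mu_recursive g ->
    (forall v : k.-tuple nat, h [tuple of 0 :: v] = f v) ->
    (forall n (v : k.-tuple nat), h [tuple of n.+1 :: v] =
       g [tuple of n :: h [tuple of n :: v] :: v]) ->
    mu_recursive h
| mu_min k (f : k.+1.-tuple nat -> nat) (h : k.-tuple nat -> nat) :
    mu_recursive f ->
    (forall v : k.-tuple nat, f [tuple of h v :: v] = 0) ->
    (forall (v : k.-tuple nat) m, m < h v -> f [tuple of m :: v] <> 0) ->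
    mu_recursive h.

Definition computable_fun (f : nat -> nat) : Prop :=
  mu_recursive (fun v : 1.-tuple nat => f (thead v)).

Definition computable_set2 (A : set (nat * nat)) : Prop :=
  exists chi : 2.-tuple nat -> nat, mu_recursive chi /\
    forall i j, chi [tuple i; j] = if `[< A (i, j) >] then 1 else 0.

Definition ce_set (A : set nat) : Prop :=
  A = set0 \/ exists f, computable_fun f /\ A = range f.

Definition ce_set2 (A : set (nat * nat)) : Prop :=
  A = set0 \/ exists f g, [/\ computable_fun f, computable_fun g &
                           A = range (fun n => (f n, g n))].

Record finite_set_coding (br : nat -> set nat) : Prop := FiniteSetCoding {
  coding_onto : range br = [set A | finite_set A /\ A !=set0];
  coding_computable : computable_set2 [set p | br p.1 p.2];
  coding_bounded : exists phi, computable_fun phi /\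
    forall j, br j `<=` [set i | i <= phi j] }.

Record computable_space (X : topologicalType) (I : nat -> set X) : Prop :=
  ComputableSpace {
  space_basis : basis (range I);
  space_ce : exists C D : set (nat * nat), [/\ ce_set2 C, ce_set2 D &
    [/\ forall i j, D (i, j) -> I i `&` I j = set0,
        forall i j, C (i, j) -> I i `<=` I j,
        forall x y, x <> y -> exists i j, [/\ I i x, I j y & D (i, j)] &
        forall x i j, (I i `&` I j) x ->
          exists k, [/\ I k x, C (k, i) & C (k, j)]]] }.

Definition finite_union (X : Type) (br : nat -> set nat) (I : nat -> set X)
  (j : nat) : set X := \bigcup_(i in br j) I i.

Definition semicomputable (X : topologicalType) (br : nat -> set nat)
    (I : nat -> set X) (S : set X) : Prop :=
  compact S /\ ce_set [set j | S `<=` finite_union br I j].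

Definition ce_closed (X : topologicalType) (I : nat -> set X) (S : set X) :
  Prop := closed S /\ ce_set [set i | I i `&` S !=set0].

Definition computable_compact (X : topologicalType) (br : nat -> set nat)
    (I : nat -> set X) (S : set X) : Prop :=
  [/\ compact S, ce_closed I S & semicomputable br I S].

Definition homeomorphism (T U : topologicalType) (f : T -> U) : Prop :=
  continuous f /\
  exists g : U -> T, [/\ cancel f g, cancel g f & continuous g].

(* For n > 0 the condition singles out the last coordinate x_n. *)
Definition half_space (R : realType) (n : nat) : set 'rV[R]_n :=
  [set x : 'rV[R]_n | forall i : 'I_n, i = n.-1 :> nat -> (0 <= x ord0 i)%R].

Definition half_space_bd (R : realType) (n : nat) : set 'rV[R]_n :=
  [set x : 'rV[R]_n | forall i : 'I_n, i = n.-1 :> nat -> x ord0 i = 0%R].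

Arguments half_space : clear implicits.
Arguments half_space_bd : clear implicits.

(* Subsets coerced to [set_type] carry the subspace topology. *)
Definition euclidean_at (R : realType) (n : nat) (M : topologicalType) (x : M) :
  Prop := exists N : set M, nbhs x N /\
    exists f : 'rV[R]_n -> set_type N, homeomorphism f.

Definition half_euclidean_at (R : realType) (n : nat) (M : topologicalType)
    (x : M) : Prop :=
  exists N : set M, nbhs x N /\
    exists f : set_type (half_space R n) -> set_type N, homeomorphism f /\
      exists p, half_space_bd R n (set_val p) /\ set_val (f p) = x.

Definition manifold_with_boundary (R : realType) (n : nat)
    (M : topologicalType) : Prop :=
  forall x : M, euclidean_at R n x \/ half_euclidean_at R n x.

Definition manifold_boundary (R : realType) (n : nat) (M : topologicalType) :
  set M := [set x | half_euclidean_at R n x].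

Arguments manifold_boundary : clear implicits.

(* Main.v *)
Require Import Defs.
From mathcomp Require Import all_boot all_order all_algebra.
From mathcomp Require Import all_classical all_reals all_analysis.
From mathcomp Require Import zify ring lra.
Import Order.TTheory GRing.Theory Num.Theory.
Import numFieldNormedType.Exports.

Set Implicit Arguments.
Unset Strict Implicit.
Unset Printing Implicit Defensive.

Local Open Scope classical_set_scope.

(** By compactness it suffices to enumerate, near each point of S, the basic
    sets I_i meeting S.  Take a cube Q around the point in a chart (a half-cube
    standing on the boundary in the second case).  If I_i meets S at a point y
    of the chart near its centre, then S minus I_i is covered, inside the chart,
    by the pairs of compact sets {x_k <= y_k - e}, {x_k >= y_k + e}; these can be
    enclosed in pairs of finite unions of basic sets that are formally disjoint
    from each other and from the faces of Q, and such coverings can be searched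
    for effectively.  For the bottom face of a half-cube "disjoint from the face"
    is verified with the help of the semicomputability of the boundary.
    Conversely, if such a covering is found and I_i missed S, then Q would be
    covered by disjoint pairs of open sets, each pair separating two opposite
    faces, which contradicts Kuhn's cubical form of Sperner's lemma.  That
    lemma is proved by Stokes' theorem modulo 2 for the cup product of the
    coboundaries of the labels.  The same covering theorem shows that a point
    with positive last coordinate in a half-space chart is not a boundary
    point. *)

(** * Computable functions and c.e. predicates *)

Lemma mu_recursive_ext k (f g : k.-tuple nat -> nat) :
  f =1 g -> mu_recursive f -> mu_recursive g.
Proof. by move=> /funext ->. Qed.

(** Arguments are read off with [nth], so that on the explicit tuples of [mu_prim] and [mu_min] they
    reduce by computation. *)
Definition mu1 (f : nat -> nat) :=
  mu_recursive (fun v : 1.-tuple nat => f (nth 0 v 0)).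
Definition mu2 (f : nat -> nat -> nat) :=
  mu_recursive (fun v : 2.-tuple nat => f (nth 0 v 0) (nth 0 v 1)).
Definition mu3 (f : nat -> nat -> nat -> nat) :=
  mu_recursive (fun v : 3.-tuple nat => f (nth 0 v 0) (nth 0 v 1) (nth 0 v 2)).

Lemma mu1E f : mu1 f = computable_fun f.
Proof.
congr mu_recursive; apply: funext => v.
by rewrite /thead (tnth_nth 0).
Qed.

Lemma mu_nth k i : i < k -> mu_recursive (fun v : k.-tuple nat => nth 0 v i).
Proof.
move=> ik; apply: mu_recursive_ext (mu_proj (Ordinal ik)) => v.
by rewrite (tnth_nth 0).
Qed.

Lemma mu_app1 f k (F : k.-tuple nat -> nat) :
  mu1 f -> mu_recursive F -> mu_recursive (fun v => f (F v)).
Proof.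
move=> hf hF.
apply: mu_recursive_ext (mu_comp hf (g := fun=> F) (fun=> hF)) => v.
by rewrite -[0]/(val (ord0 : 'I_1)) -tnth_nth tnth_mktuple.
Qed.

Lemma mu_app2 f k (F G : k.-tuple nat -> nat) :
  mu2 f -> mu_recursive F -> mu_recursive G ->
  mu_recursive (fun v => f (F v) (G v)).
Proof.
move=> hf hF hG.
pose g (i : 'I_2) := if i == 0 :> nat then F else G.
have hg i : mu_recursive (g i) by rewrite /g; case: ifP.
apply: mu_recursive_ext (mu_comp hf hg) => v.
rewrite -[0]/(val (@Ordinal 2 0 isT)) -[1]/(val (@Ordinal 2 1 isT)).
by rewrite -!tnth_nth !tnth_mktuple.
Qed.

Lemma mu2_rec f g h : mu1 f -> mu3 g ->
  (forall p, h 0 p = f p) -> (forall m p, h m.+1 p = g m (h m p) p) -> mu2 h.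
Proof.
move=> hf hg h0 hS; apply: (mu_prim hf hg) => [v|m v] /=.
  exact: h0.
exact: hS.
Qed.

Lemma mu1_id : mu1 id.
Proof. exact: mu_nth. Qed.

Lemma mu1_succ : mu1 succn.
Proof. rewrite mu1E; exact: mu_succ. Qed.

Lemma mu_const k c : mu_recursive (fun _ : k.-tuple nat => c).
Proof.
elim: c => [|c IH]; last exact: (mu_app1 mu1_succ IH).
apply: mu_recursive_ext (@mu_comp 0 k _ (fun=> fun=> 0) mu_zero _) => //.
by case.
Qed.

Lemma mu2_add : mu2 addn.
Proof.
apply: (@mu2_rec id (fun _ a _ => a.+1)) => //; first exact: mu1_id.
by apply: (mu_app1 mu1_succ); apply: mu_nth.
Qed.

Lemma mu2_mul : mu2 muln.
Proof.
apply: (@mu2_rec (fun=> 0) (fun _ a p => p + a)) => //; first exact: mu_const.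
by apply: (mu_app2 mu2_add); apply: mu_nth.
Qed.

Lemma mu1_pred : mu1 predn.
Proof.
(* [mu2_rec] carries one parameter, so the predecessor is first defined with a dummy second
   argument. *)
have h : mu2 (fun m _ => m.-1).
  by apply: (@mu2_rec (fun=> 0) (fun m _ _ => m)) => //;
    [exact: mu_const|exact: mu_nth].
exact: (mu_app2 h (mu_nth _) (mu_const _ 0)).
Qed.

Lemma mu2_sub : mu2 subn.
Proof.
(* The recursion runs over the subtrahend, hence the swapped arguments. *)
have h : mu2 (fun m p => p - m).
  apply: (@mu2_rec id (fun _ a _ => a.-1)) => [||p|m p].
  - exact: mu1_id.
  - by apply: (mu_app1 mu1_pred); apply: mu_nth.
  - by rewrite subn0.
  - by rewrite subnS.
by apply: (mu_app2 h); apply: mu_nth.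
Qed.

(** * Integer square roots and pairing *)

Lemma isqrt_subproof z : exists s, z < s.+1 * s.+1.
Proof. by exists z; nia. Qed.
Definition isqrt z := ex_minn (isqrt_subproof z).

Lemma mu1_isqrt : mu1 isqrt.
Proof.
(* Subtraction is truncated: [f m z] vanishes exactly when z < (m+1)^2. *)
pose f m z := z.+1 - m.+1 * m.+1.
have hf : mu2 f.
  apply: (mu_app2 mu2_sub); first by apply: (mu_app1 mu1_succ); apply: mu_nth.
  by apply: (mu_app2 mu2_mul); apply: (mu_app1 mu1_succ); apply: mu_nth.
apply: (mu_min hf) => [v|v m] /=; rewrite /f /isqrt; case: ex_minnP => s hs hmin.
- by lia.
- by move=> ms h0; have := hmin m; lia.
Qed.

(* An injective, not surjective, pairing: [x + y] is the integer square root
   of the code. *)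
Definition cpair x y := (x + y) * (x + y) + x.
Definition cfst z := z - isqrt z * isqrt z.
Definition csnd z := isqrt z - cfst z.

Lemma isqrt_cpair x y : isqrt (cpair x y) = x + y.
Proof.
rewrite /isqrt /cpair; case: ex_minnP => s hs hmin.
by have := hmin (x + y); nia.
Qed.

Lemma cpairK1 x y : cfst (cpair x y) = x.
Proof. by rewrite /cfst isqrt_cpair /cpair; lia. Qed.

Lemma cpairK2 x y : csnd (cpair x y) = y.
Proof. by rewrite /csnd isqrt_cpair cpairK1; lia. Qed.

Lemma computable_comp f g : computable_fun f -> computable_fun g ->
  computable_fun (fun z => f (g z)).
Proof. rewrite -!mu1E => hf hg; exact: (mu_app1 hf hg). Qed.

Lemma computable_id : computable_fun id.
Proof. rewrite -mu1E; exact: mu1_id. Qed.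

Lemma computable_const c : computable_fun (fun=> c).
Proof. rewrite -mu1E; exact: mu_const. Qed.

Lemma computable_app2 f g h : mu2 f -> computable_fun g -> computable_fun h ->
  computable_fun (fun z => f (g z) (h z)).
Proof. rewrite -!mu1E => hf hg hh; exact: (mu_app2 hf hg hh). Qed.

Definition computable_add := fun f g => @computable_app2 _ f g mu2_add.
Definition computable_mul := fun f g => @computable_app2 _ f g mu2_mul.
Definition computable_sub := fun f g => @computable_app2 _ f g mu2_sub.

Lemma computable_succ f : computable_fun f -> computable_fun (fun z => (f z).+1).
Proof. by apply: computable_comp; rewrite -mu1E; exact: mu1_succ. Qed.

Lemma mu2_cpair : mu2 cpair.
Proof.
apply: (mu_app2 mu2_add); last by apply: mu_nth.
by apply: (mu_app2 mu2_mul); exact: mu2_add.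
Qed.

Lemma computable_pair f g : computable_fun f -> computable_fun g ->
  computable_fun (fun z => cpair (f z) (g z)).
Proof. exact: computable_app2 mu2_cpair. Qed.

Lemma computable_isqrt : computable_fun isqrt.
Proof. rewrite -mu1E; exact: mu1_isqrt. Qed.

Lemma computable_cfst f :
  computable_fun f -> computable_fun (fun z => cfst (f z)).
Proof.
apply: computable_comp; apply: computable_sub; first exact: computable_id.
by apply: computable_mul; exact: computable_isqrt.
Qed.

Lemma computable_csnd f :
  computable_fun f -> computable_fun (fun z => csnd (f z)).
Proof.
apply: computable_comp; apply: computable_sub; first exact: computable_isqrt.
by apply: computable_cfst; exact: computable_id.
Qed.

Fixpoint nrec (f : nat -> nat) (g : nat -> nat) m z :=
  if m is m'.+1 then g (cpair m' (cpair (nrec f g m' z) z)) else f z.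

Lemma computable_nrec f g b p : computable_fun f -> computable_fun g ->
  computable_fun b -> computable_fun p ->
  computable_fun (fun z => nrec f g (b z) (p z)).
Proof.
rewrite -!mu1E => hf hg hb hp.
have h : mu2 (nrec f g).
  apply: (@mu2_rec f (fun m a p => g (cpair m (cpair a p)))) => //.
  apply: (mu_app1 hg); apply: (mu_app2 mu2_cpair); first exact: mu_nth.
  by apply: (mu_app2 mu2_cpair); exact: mu_nth.
exact: (mu_app2 h hb hp).
Qed.

(** Truth is the value 0, so that sums express conjunctions and products disjunctions. *)
Definition dec (P : nat -> Prop) :=
  exists2 f, computable_fun f & forall z, P z <-> f z = 0.

Definition sigma1 (P : nat -> Prop) :=
  exists2 f, computable_fun f & forall z, P z <-> exists m, f (cpair m z) = 0.

Lemma sigma1_ext (P Q : nat -> Prop) :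
  (forall z, P z <-> Q z) -> sigma1 P -> sigma1 Q.
Proof. by move=> PQ [f hf h]; exists f => // z; rewrite -PQ. Qed.

Lemma dec_sigma1 P : dec P -> sigma1 P.
Proof.
move=> [f hf h]; exists (fun z => f (csnd z)).
  by apply: computable_comp => //; exact: computable_csnd computable_id.
move=> z; rewrite h; split => [fz|[m]]; last by rewrite cpairK2.
by exists 0; rewrite cpairK2.
Qed.

Lemma dec_leq f g : computable_fun f -> computable_fun g ->
  dec (fun z => f z <= g z).
Proof.
move=> hf hg; exists (fun z => f z - g z); first exact: computable_sub.
by move=> z; lia.
Qed.

Lemma dec_eq f g : computable_fun f -> computable_fun g ->
  dec (fun z => f z = g z).
Proof.
move=> hf hg; exists (fun z => (f z - g z) + (g z - f z)).
  by apply: computable_add; exact: computable_sub.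
by move=> z; lia.
Qed.

Lemma dec_not P : dec P -> dec (fun z => ~ P z).
Proof.
move=> [f hf h]; exists (fun z => 1 - f z).
  by apply: computable_sub => //; exact: computable_const.
by move=> z; rewrite h; lia.
Qed.

Lemma sigma1_comp P f : sigma1 P -> computable_fun f ->
  sigma1 (fun z => P (f z)).
Proof.
move=> [g hg h] hf; exists (fun z => g (cpair (cfst z) (f (csnd z)))).
  apply: computable_comp => //; apply: computable_pair.
    exact: computable_cfst computable_id.
  by apply: computable_comp => //; exact: computable_csnd computable_id.
by move=> z; rewrite h; split=> -[m] hm; exists m; move: hm; rewrite cpairK1 cpairK2.
Qed.

Lemma sigma1_and P Q : sigma1 P -> sigma1 Q -> sigma1 (fun z => P z /\ Q z).
Proof.
move=> [f hf hP] [g hg hQ].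
exists (fun z => f (cpair (cfst (cfst z)) (csnd z)) +
                 g (cpair (csnd (cfst z)) (csnd z))).
  have h1 := computable_cfst computable_id.
  have h2 := computable_csnd computable_id.
  by apply: computable_add; apply: computable_comp => //;
    apply: computable_pair => //; [exact: computable_cfst|exact: computable_csnd].
move=> z; rewrite hP hQ; split=> [[[m hm] [k hk]]|[m]].
  by exists (cpair m k); rewrite !(cpairK1, cpairK2) hm hk.
rewrite cpairK1 cpairK2 => /eqP; rewrite addn_eq0 => /andP[/eqP h1 /eqP h2].
by split; [exists (cfst m)|exists (csnd m)].
Qed.

Lemma sigma1_or P Q : sigma1 P -> sigma1 Q -> sigma1 (fun z => P z \/ Q z).
Proof.
move=> [f hf hP] [g hg hQ].
exists (fun z => f z * g z); first exact: computable_mul.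
move=> z; rewrite hP hQ; split.
  by move=> [] [m hm]; exists m; rewrite hm ?muln0.
by move=> [m] /eqP; rewrite muln_eq0 => /orP[] /eqP hm; [left|right]; exists m.
Qed.

Lemma sigma1_ex (P : nat -> nat -> Prop) :
  sigma1 (fun w => P (cfst w) (csnd w)) -> sigma1 (fun z => exists x, P x z).
Proof.
move=> [f hf hP0].
have hP x z : P x z <-> exists m, f (cpair m (cpair x z)) = 0.
  by rewrite -hP0 cpairK1 cpairK2.
exists (fun z => f (cpair (cfst (cfst z)) (cpair (csnd (cfst z)) (csnd z)))).
  have h1 := computable_cfst computable_id.
  have h2 := computable_csnd computable_id.
  apply: computable_comp => //; apply: computable_pair.
    exact: computable_cfst.
  by apply: computable_pair => //; exact: computable_csnd.
move=> z; split=> [[x /hP[m hm]]|[m hm]].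
  by exists (cpair m x); rewrite !(cpairK1, cpairK2).
exists (csnd m); apply/hP; exists (cfst m); move: hm.
by rewrite !(cpairK1, cpairK2).
Qed.

(** Finitely many witnesses have a common bound M, so a single search for M suffices. [B M y] is a
    product that vanishes when some witness for [y] lies below M; [A] sums these products over all x
    below the bound. *)
Lemma sigma1_forall_lt (P : nat -> nat -> Prop) b :
  sigma1 (fun w => P (cfst w) (csnd w)) -> computable_fun b ->
  sigma1 (fun z => forall x, x < b z -> P x z).
Proof.
move=> [f hf hP0] hb.
have hP x z : P x z <-> exists m, f (cpair m (cpair x z)) = 0.
  by rewrite -hP0 cpairK1 cpairK2.
have h0 : computable_fun id := computable_id.
pose B := nrec (fun=> 1) (fun w => cfst (csnd w) * f (cpair (cfst w) (csnd (csnd w)))).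
have BP M y : B M y = 0 <-> exists2 m, m < M & f (cpair m y) = 0.
  elim: M => [|M IH]; first by split=> //= -[].
  rewrite /B /= -/B !(cpairK1, cpairK2); split.
    move=> /eqP; rewrite muln_eq0 => /orP[/eqP/IH [m mM hm]|/eqP hM].
      by exists m => //; lia.
    by exists M.
  move=> [m]; rewrite ltnS leq_eqVlt => /orP[/eqP -> ->|mM hm].
    by rewrite muln0.
  by have -> : B M y = 0 by apply/IH; exists m.
have hB g h : computable_fun g -> computable_fun h ->
    computable_fun (fun z => B (g z) (h z)).
  move=> hg hh; apply: computable_nrec => //; first exact: computable_const.
  apply: computable_mul; first exact/computable_cfst/computable_csnd.
  apply: (computable_comp hf); apply: computable_pair; first exact: computable_cfst.
  exact/computable_csnd/computable_csnd.
pose A := nrec (fun=> 0) (fun w => cfst (csnd w) +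
   B (cfst (csnd (csnd w))) (cpair (cfst w) (csnd (csnd (csnd w))))).
have AP k M z : A k (cpair M z) = 0 <-> forall x, x < k -> B M (cpair x z) = 0.
  elim: k => [|k IH]; first by split.
  rewrite /A /= -/A !(cpairK1, cpairK2); split.
    move=> /eqP; rewrite addn_eq0 => /andP[/eqP/IH h1 /eqP h2] x.
    by rewrite ltnS leq_eqVlt => /orP[/eqP ->|/h1].
  move=> h; rewrite h //.
  by have -> : A k (cpair M z) = 0 by apply/IH => x xk; apply: h; lia.
exists (fun w => A (b (csnd w)) (cpair (cfst w) (csnd w))).
  have h1 := computable_cfst h0; have h2 := computable_csnd h0.
  apply: computable_nrec; first exact: computable_const.
  - apply: computable_add; first exact: computable_cfst.
    apply: hB; first exact/computable_cfst/computable_csnd.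
    by apply: computable_pair => //; exact/computable_csnd/computable_csnd.
  - exact: computable_comp.
  - exact: computable_pair.
move=> z; split.
  move=> h.
  have {}h x : x < b z -> exists m, f (cpair m (cpair x z)) = 0.
    by move=> /h/hP.
  suff [M hM] : exists M, forall x, x < b z -> B M (cpair x z) = 0.
    by exists M; rewrite cpairK1 cpairK2; apply/AP.
  elim: (b z) h => [|k IH] h; first by exists 0.
  have [M hM] := IH (fun x xk => h x (leqW xk)).
  have [m hm] := h k (leqnn _).
  exists (maxn M m.+1) => x; rewrite ltnS leq_eqVlt => /orP[/eqP ->|xk].
    by apply/BP; exists m => //; lia.
  by have /BP[m' ? ?] := hM _ xk; apply/BP; exists m' => //; lia.
move=> [M]; rewrite cpairK1 cpairK2 => /AP h x xb.
by have /BP[m _ hm] := h x xb; apply/hP; exists m.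
Qed.

Lemma sigma1_ce P : sigma1 P -> ce_set [set i | P i].
Proof.
move=> [f hf hP].
have [[a Pa]|nP] := pselect (exists a, P a); last first.
  by left; apply/seteqP; split=> [i /= Pi|//]; apply: nP; exists i.
right.
(* output the component [csnd w] if it is verified by [cfst w], else [a] *)
pose c w := f (cpair (cfst w) (csnd w)).
pose h w := (1 - c w) * csnd w + (1 - (1 - c w)) * a.
have h0 : computable_fun id := computable_id.
have hc : computable_fun c.
  by apply: computable_comp => //; apply: computable_pair;
    [exact: computable_cfst|exact: computable_csnd].
have h1 : computable_fun (fun z => 1 - c z).
  by apply: computable_sub => //; exact: computable_const.
exists h; split.
  apply: computable_add; apply: computable_mul => //.
  - exact: computable_csnd.
  - by apply: computable_sub => //; exact: computable_const.
  - exact: computable_const.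
apply/seteqP; split => x /=.
  move=> /hP [m hm]; exists (cpair m x) => //.
  by rewrite /h /c cpairK1 cpairK2 hm mul1n addn0.
move=> [w _ <-]; rewrite /h; case: (posnP (c w)) => hw.
  by rewrite hw mul1n addn0; apply/hP; exists (cfst w).
have -> : 1 - c w = 0 by lia.
by rewrite mul0n add0n mul1n.
Qed.

Lemma ce_sigma1 A : ce_set A -> sigma1 A.
Proof.
move=> [->|[f [hf ->]]].
  by exists (fun=> 1); [exact: computable_const|move=> z; split=> // -[]].
have h0 : computable_fun id := computable_id.
apply: (@sigma1_ext (fun z => exists x, f x = z)).
  by move=> z; split=> [[x <-]|[x _ <-]]; exists x.
apply: sigma1_ex; apply: dec_sigma1; apply: dec_eq; last exact: computable_csnd.
by apply: computable_comp => //; exact: computable_cfst.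
Qed.

Lemma ce_sigma1_2 A f g : ce_set2 A -> computable_fun f -> computable_fun g ->
  sigma1 (fun z => A (f z, g z)).
Proof.
move=> [->|[u [v [hu hv ->]]]] hf hg.
  by exists (fun=> 1); [exact: computable_const|move=> z; split=> // -[]].
have h0 : computable_fun id := computable_id.
apply: (@sigma1_ext (fun z => exists x, u x = f z /\ v x = g z)).
  by move=> z; split=> [[x [<- <-]]|[x _ [h1 h2]]]; exists x.
apply: sigma1_ex; have h1 := computable_cfst h0; have h2 := computable_csnd h0.
by apply: sigma1_and; apply: dec_sigma1; apply: dec_eq; exact: computable_comp.
Qed.

(** * Quantifiers over coded finite sets *)

Section FiniteSets.
Variables (br : nat -> set nat) (hbr : finite_set_coding br).

Lemma dec_mem f g : computable_fun f -> computable_fun g ->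
  dec (fun z => br (f z) (g z)).
Proof.
move=> hf hg; have [chi [hchi chiE]] := coding_computable hbr.
have h2 : mu2 (fun i j => chi [tuple i; j]).
  apply: mu_recursive_ext hchi => v; congr chi.
  by apply/val_inj; case: v => -[|x [|y []]].
exists (fun z => 1 - chi [tuple f z; g z]).
  apply: computable_sub; first exact: computable_const.
  exact: (computable_app2 h2).
by move=> z; rewrite chiE; case: asboolP => /= h; split.
Qed.

(** The elements of a coded set lie below the computable bound [phi] and membership is decidable, so
    this is a bounded quantifier over a disjunction. *)
Lemma sigma1_forall_mem (P : nat -> nat -> Prop) j :
  sigma1 (fun w => P (cfst w) (csnd w)) -> computable_fun j ->
  sigma1 (fun z => forall p, br (j z) p -> P p z).
Proof.
move=> hP hj; have [phi [hphi phiE]] := coding_bounded hbr.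
have h0 : computable_fun id := computable_id.
apply: (@sigma1_ext (fun z => forall p, p < (phi (j z)).+1 ->
    ~ br (j z) p \/ P p z)).
  move=> z; split=> h p.
    move=> bp; have [] // := h p; first by rewrite ltnS; exact: (phiE _ _ bp).
  move=> _.
  by have [bp|nbp] := pselect (br (j z) p); [right; exact: h|left].
apply: sigma1_forall_lt.
  apply: sigma1_or => //; apply: dec_sigma1; apply: dec_not; apply: dec_mem.
    by apply: computable_comp => //; exact: computable_csnd.
  exact: computable_cfst.
by apply: computable_succ; exact: computable_comp.
Qed.

(** The separate head [x] keeps the set nonempty: only nonempty sets have codes. *)
Lemma code_of_seq (x : nat) (s : seq nat) :
  exists j, forall i, br j i <-> i \in x :: s.
Proof.
have : [set i | i \in x :: s] \in range br.
  rewrite inE (coding_onto hbr); split; first exact: finite_seq.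
  by exists x => /=; rewrite mem_head.
by rewrite inE => -[j _ e]; exists j => i; rewrite e.
Qed.

End FiniteSets.

(** * Kuhn's lemma *)

Section Kuhn.
Variable (I : finType).
Implicit Types (v w q : I -> nat) (A : {set I}) (es s : seq I).
Local Open Scope ring_scope.

Let addFF (x : 'F_2) : x + x = 0.
Proof. by rewrite addrr_pchar2 // pchar_Fp. Qed.

Definition upd v a (t : nat) := fun i => if i == a then t else v i.
Definition incr v a := upd v a (v a).+1.

Lemma upd_id v a t : upd v a t a = t.
Proof. by rewrite /upd eqxx. Qed.

Lemma upd_neq v a t i : i != a -> upd v a t i = v i.
Proof. by rewrite /upd => /negbTE ->. Qed.

Lemma upd_comm v a b t u :
  a != b -> upd (upd v a t) b u = upd (upd v b u) a t.
Proof.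
move=> ab; apply: funext => i; rewrite /upd.
by case: (eqVneq i b) => // ->; rewrite eq_sym (negbTE ab).
Qed.

Lemma incr_comm v a b : a != b -> incr (incr v a) b = incr (incr v b) a.
Proof.
move=> ab; rewrite /incr upd_comm ?[b == a]eq_sym //.
by rewrite (upd_neq _ _ ab) upd_neq // eq_sym.
Qed.

Lemma incr_upd v a t : incr (upd v a t) a = upd v a t.+1.
Proof.
by apply: funext => i; rewrite /incr upd_id /upd; case: eqVneq.
Qed.

(** Every unordered pair is counted twice; the ranks in the enumeration of [I] split the sum into
    two equal halves. *)
Lemma sum_sym_F2 A (f : I -> I -> 'F_2) : (forall a b, f a b = f b a) ->
  \sum_(a in A) \sum_(b in A :\ a) f a b = 0.
Proof.
move=> fC; pose r (x : I) := enum_rank x.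
have E a : \sum_(b in A :\ a) f a b =
    \sum_(b in A | (r a < r b)%N) f a b + \sum_(b in A | (r b < r a)%N) f a b.
  rewrite (bigID (fun b => (r a < r b)%N)) /=; congr (_ + _); apply: eq_bigl => b;
    rewrite !inE; case: (eqVneq b a) => [->|ba]; rewrite ?ltnn ?andbF //=.
  rewrite -leqNgt leq_eqVlt; case: eqP => //= /val_inj/enum_rank_inj e.
  by rewrite e eqxx in ba.
rewrite (eq_bigr _ (fun a _ => E a)) big_split /=.
rewrite [X in _ + X](exchange_big_dep (fun b => b \in A)) /=;
  last by move=> a b _ /andP[].
rewrite [X in _ + X](eq_bigr (fun b => \sum_(a in A | (r b < r a)%N) f b a)).
  exact: addFF.
move=> b bA; apply: eq_big => [a|a _]; last by rewrite fC.
by rewrite bA.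
Qed.

(** * Cup products of labels and Stokes' theorem modulo 2 *)

Section Labelling.
Variables (lab : I -> (I -> nat) -> 'F_2).

(* The cup product of the coboundaries of the labels [es], summed over the
   simplices of Kuhn's triangulation of the cube [v + \{0,1\}^A]. *)
Fixpoint cup es A v : 'F_2 :=
  if es is e :: es' then
    \sum_(a in A) (lab e v + lab e (incr v a)) * cup es' (A :\ a) (incr v a)
  else 1.

(** The cup product of coboundaries is a cocycle: modulo 2 the back faces of a cube contribute as
    much as the front faces. *)
Lemma cup_closed es A v :
  \sum_(a in A) cup es (A :\ a) (incr v a) = \sum_(a in A) cup es (A :\ a) v.
Proof.
elim: es A v => [//|e es IH] A v /=.
pose g u a b := lab e u * cup es (A :\ a :\ b) (incr (incr v a) b).
have gC u a b : lab e u * cup es (A :\ a :\ b) (incr (incr v a) b) =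
    lab e u * cup es (A :\ b :\ a) (incr (incr v b) a).
  have [->//|ab] := eqVneq a b; rewrite incr_comm //.
  by congr (_ * cup _ _ _); apply/setP => x; rewrite !inE andbCA.
(* Both sides reduce to the sum of [h]. The other terms carry [lab e] at the vertex moved along both
   a and b on the left, and at [v] on the right; they are symmetric in a and b and cancel. *)
pose h a b := lab e (incr v a) * cup es (A :\ a :\ b) (incr (incr v a) b).
transitivity (\sum_(a in A) \sum_(b in A :\ a) h a b).
  under eq_bigr => a aA.
    under eq_bigr => b bA do rewrite mulrDl.
    rewrite big_split /=.
    over.
  rewrite big_split /= [X in _ + X]sum_sym_F2 ?addr0 // => a b.
  have [->//|ab] := eqVneq a b; rewrite incr_comm //.
  by congr (_ * cup _ _ _); apply/setP => x; rewrite !inE andbCA.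
symmetry.
transitivity (\sum_(b in A) \sum_(a in A :\ b)
   (lab e v + lab e (incr v b)) * cup es (A :\ b :\ a) (incr v b)).
  rewrite (exchange_big_dep (fun b => b \in A)) /=; last first.
    by move=> a b _; rewrite !inE => /andP[].
  apply: eq_bigr => b bA; apply: eq_big => [a|a _].
    by rewrite !inE bA andbT eq_sym andbC.
  by congr (_ * cup _ _ _); apply/setP => x; rewrite !inE andbCA.
under eq_bigr => b bA.
  rewrite -mulr_sumr -IH mulrDl !mulr_sumr.
  over.
by rewrite big_split /= [X in X + _]sum_sym_F2 ?add0r.
Qed.

Variable N : nat.

(** A sum over the base points of the unit cubes of the grid: coordinates stop at N-1, and those
    outside [s] are kept from [v]. *)
Fixpoint box_sum s (g : (I -> nat) -> 'F_2) v : 'F_2 :=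
  if s is a :: s' then \sum_(t < N) box_sum s' g (upd v a t) else g v.

Lemma eq_box_sum s f g v :
  (forall w, (forall i, i \in s -> (w i < N)%N) ->
     (forall i, i \notin s -> w i = v i) -> f w = g w) ->
  box_sum s f v = box_sum s g v.
Proof.
elim: s v => [|a s IH] v H /=; first exact: H.
apply: eq_bigr => t _; apply: IH => w h1 h2; apply: H => i.
  rewrite inE; case: (boolP (i \in s)) => [/h1//|is_]; rewrite orbF => /eqP ia.
  by rewrite h2 // ia upd_id.
by rewrite inE negb_or => /andP[ia /h2 ->]; rewrite upd_neq.
Qed.

Lemma box_sum_sum J (r : seq J) (P : pred J) s f v :
  box_sum s (fun w => \sum_(j <- r | P j) f j w) v =
  \sum_(j <- r | P j) box_sum s (f j) v.
Proof.
elim: s v => [//|a s IH] v /=.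
by rewrite exchange_big /=; apply: eq_bigr => t _; rewrite IH.
Qed.

Lemma box_sum0 s v : box_sum s (fun=> 0) v = 0.
Proof. by elim: s v => [//|a s IH] v /=; rewrite big1. Qed.

Lemma box_sum_upd s g v a t : a \notin s ->
  box_sum s g (upd v a t) = box_sum s (fun w => g (upd w a t)) v.
Proof.
elim: s v => [//|b s IH] v; rewrite inE negb_or => /andP[ab as_] /=.
by apply: eq_bigr => u _; rewrite upd_comm // IH.
Qed.

Lemma telescope_F2 (G : nat -> 'F_2) m :
  \sum_(t < m) (G t.+1 + G t) = G m + G 0%N.
Proof.
elim: m => [|m IH]; first by rewrite big_ord0 addFF.
rewrite big_ord_recr IH; change (G m + G 0%N + (G m.+1 + G m) = G m.+1 + G 0%N).
by rewrite addrC -addrA [G m + (_ + _)]addrA addFF add0r.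
Qed.

(** Summation along the direction [a] telescopes and leaves the two faces of the box orthogonal to
    it. *)
Lemma box_sum_telescope s (G : (I -> nat) -> 'F_2) a v : uniq s -> a \in s ->
  box_sum s (fun w => G (incr w a) + G w) v =
  box_sum (rem a s) (fun w => G (upd w a N) + G (upd w a 0%N)) v.
Proof.
elim: s v => [//|b s IH] v /= /andP[bs us]; rewrite inE.
case: (eqVneq b a) => [e _|ba]; last first.
  by move=> /= as_; apply: eq_bigr => t _; exact: IH.
rewrite -e; under eq_bigr => t _ do rewrite box_sum_upd //.
rewrite -box_sum_sum; apply: eq_box_sum => w _ _.
rewrite -(telescope_F2 (fun t => G (upd w b t))); apply: eq_bigr => t _.
by rewrite incr_upd.
Qed.

Hypothesis lab0 : forall e v, (forall i, v i <= N)%N -> v e = 0%N -> lab e v = 0.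
Hypothesis labN : forall e v, (forall i, v i <= N)%N -> v e = N -> lab e v = 1.

Lemma incr_bound A v a : a \in A -> (forall i, v i <= N)%N ->
  (forall i, i \in A -> (v i < N)%N) ->
  (forall i, incr v a i <= N)%N /\
  (forall i, i \in A :\ a -> (incr v a i < N)%N).
Proof.
move=> aA hv hA; split=> i.
  by rewrite /incr /upd; case: eqVneq => [_|_]; [exact: hA|exact: hv].
by rewrite !inE => /andP[ia iA]; rewrite /incr upd_neq //; exact: hA.
Qed.

(** On a face where coordinate [e] is constantly 0 or N the label [e] is constant, so its coboundary
    vanishes. *)
Lemma cup_face es A v e : e \in es -> e \notin A -> (forall i, v i <= N)%N ->
  (forall i, i \in A -> (v i < N)%N) -> v e = 0%N \/ v e = N ->
  cup es A v = 0.
Proof.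
elim: es A v => [//|e' es IH] A v + eA hv hA he /=.
rewrite inE; case: (eqVneq e e') => [<- _|_ /= ees]; apply: big1 => a aA.
  have ea : e != a by apply: contraNneq eA => ->.
  have [hv' hA'] := incr_bound aA hv hA.
  have vE : incr v a e = v e by rewrite /incr upd_neq.
  case: he => he.
    by rewrite !lab0 ?vE // addr0 mul0r.
  by rewrite !labN ?vE // addFF mul0r.
have [hv' hA'] := incr_bound aA hv hA.
rewrite IH ?mulr0 // ?inE ?(negbTE eA) ?andbF //.
by rewrite /incr upd_neq //; apply: contraNneq eA => ->.
Qed.

(** Stokes' theorem: the product is the coboundary of [lab e] times the cocycle of the remaining
    labels. The faces orthogonal to a direction other than [e] vanish by [cup_face]; of the two
    orthogonal to [e] only the upper one, with label 1, remains, and it carries the sum for [es]. *)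
Lemma box_sum_cup es v : uniq es -> (forall i, v i <= N)%N ->
  box_sum es (cup es [set i in es]%SET) v = 1.
Proof.
elim: es v => [//|e es IH] v ues hv.
have /andP[ees ues'] : (e \notin es) && uniq es := ues.
set A := [set i in e :: es]%SET.
have AD : A :\ e = [set i in es]%SET.
  apply/setP => i; rewrite !inE; case: (eqVneq i e) => //= ->.
  by rewrite (negbTE ees).
pose G a w := lab e w * cup es (A :\ a) w.
transitivity (box_sum (e :: es)
    (fun w => \sum_(a in A) (G a (incr w a) + G a w)) v).
  (* In the terms with the factor [lab e w], [cup_closed] replaces the back faces by the front
     faces. *)
  apply: eq_box_sum => w _ _; rewrite [LHS]/=.
  under eq_bigr do rewrite mulrDl.
  rewrite !big_split /= addrC; congr (_ + _).
  by rewrite -!mulr_sumr cup_closed.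
rewrite box_sum_sum (bigD1 e) /=; last by rewrite inE mem_head.
rewrite [X in _ + X]big1 ?addr0 => [|a /andP[aA ae]].
  rewrite -[\sum_(t < N) _]/(box_sum (e :: es) (fun w => G e (incr w e) + G e w) v).
  rewrite box_sum_telescope ?mem_head //= eqxx.
  rewrite -(IH (upd v e N)) //; last first.
    by move=> i; rewrite /upd; case: eqVneq.
  rewrite box_sum_upd //; apply: eq_box_sum => w h1 h2.
  have wN i : (w i <= N)%N.
    have [/h1/ltnW//|/h2 ->//] := boolP (i \in es).
  rewrite /G labN ?upd_id //; last by move=> i; rewrite /upd; case: eqVneq.
  rewrite lab0 ?upd_id //; last by move=> i; rewrite /upd; case: eqVneq.
  by rewrite mul0r addr0 mul1r AD.
rewrite -[\sum_(t < N) _]/(box_sum (e :: es) (fun w => G a (incr w a) + G a w) v).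
have aes : a \in es by move: aA; rewrite !inE (negbTE ae).
rewrite box_sum_telescope //; last by rewrite inE aes orbT.
rewrite -[RHS](box_sum0 (rem a (e :: es)) v); apply: eq_box_sum => w h1 h2.
have memr i : (i \in rem a (e :: es)) = (i != a) && (i \in e :: es).
  by rewrite mem_rem_uniq // !inE.
have wN i : (w i <= N)%N.
  have [/h1/ltnW//|/h2 ->//] := boolP (i \in rem a (e :: es)).
have z t : t = 0%N \/ t = N -> G a (upd w a t) = 0.
  move=> ht; rewrite /G (@cup_face _ _ _ a) ?mulr0 // ?upd_id //.
  - by rewrite !inE eqxx.
  - by move=> i; rewrite /upd; case: eqVneq => // _; case: ht => ->.
  - move=> i; rewrite 2!inE => /andP[ia]; rewrite inE => ie.
    by rewrite upd_neq //; apply: h1; rewrite memr ia.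
by rewrite !z ?addr0 //; [left|right].
Qed.

Lemma box_sum_neq0 s g v : box_sum s g v != 0 ->
  exists w, [/\ forall i, i \in s -> (w i < N)%N,
    forall i, i \notin s -> w i = v i & g w != 0].
Proof.
move=> h; apply: contrapT => /forallNP H; move: h.
rewrite -[X in _ != X](box_sum0 s v); move/negP; apply; apply/eqP.
apply: eq_box_sum => w h1 h2; apply: contrapT => /eqP h3.
by apply: (H w).
Qed.

Lemma cup_neq0 es A v : cup es A v != 0 -> forall e, e \in es ->
  exists u w, [/\ forall i, (v i <= u i <= (v i).+1)%N,
    forall i, (v i <= w i <= (v i).+1)%N & lab e u != lab e w].
Proof.
(* Strengthened for the induction: only the directions in [A] are still free, so all vertices stay
   in one unit cube. *)
suff H : cup es A v != 0 -> forall e, e \in es ->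
  exists u w, [/\ forall i, (v i <= u i <= v i + (i \in A))%N,
    forall i, (v i <= w i <= v i + (i \in A))%N & lab e u != lab e w].
  move=> h e ees; have [u [w [h1 h2 h3]]] := H h e ees.
  exists u, w; split=> // i.
    by have := h1 i; case: (i \in A); lia.
  by have := h2 i; case: (i \in A); lia.
elim: es A v => [//|e es IH] A v /= h.
have [a /andP[aA]] : exists a, (a \in A) &&
    ((lab e v + lab e (incr v a)) * cup es (A :\ a) (incr v a) != 0).
  apply/existsP; move: h; apply: contraR => /existsPn h; apply/eqP/big1 => a aA.
  by have := h a; rewrite aA /= negbK => /eqP.
rewrite mulf_eq0 negb_or => /andP[h1 h2] e'; rewrite inE.
have bnd i : (v i <= incr v a i <= v i + (i \in A))%N.
  rewrite /incr /upd; case: eqVneq => [->|_]; last lia.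
  by rewrite aA; lia.
case: (eqVneq e' e) => [-> _|_ /= e'es].
  exists v, (incr v a); split=> //; first by move=> i; lia.
  by apply: contraNneq h1 => ->; rewrite addFF.
have [u [w [hu hw huw]]] := IH _ _ h2 _ e'es.
exists u, w; split=> // i.
  have := hu i; rewrite !inE /incr /upd; case: eqVneq => [->|_] /=; last by lia.
  by rewrite aA; lia.
have := hw i; rewrite !inE /incr /upd; case: eqVneq => [->|_] /=; last by lia.
by rewrite aA; lia.
Qed.

End Labelling.

(** The total in [box_sum_cup] is 1, so some grid cube contributes a nonzero term, and on it every
    label takes both values. *)
Lemma kuhn (N : nat) (lab : I -> (I -> nat) -> bool) :
  (forall e v, (forall i, v i <= N)%N -> v e = 0%N -> lab e v = false) ->
  (forall e v, (forall i, v i <= N)%N -> v e = N -> lab e v = true) ->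
  exists q, (forall i, (q i < N)%N) /\ forall e,
    exists u w, [/\ forall i, (q i <= u i <= (q i).+1)%N,
      forall i, (q i <= w i <= (q i).+1)%N & lab e u != lab e w].
Proof.
move=> l0 lN; pose l e v : 'F_2 := (lab e v)%:R.
have := @box_sum_cup l N _ _ (enum I) (fun=> 0%N) (enum_uniq _) (fun=> leq0n _).
have h0 e v : (forall i, v i <= N)%N -> v e = 0%N -> l e v = 0.
  by move=> h1 h2; rewrite /l l0.
have h1 e v : (forall i, v i <= N)%N -> v e = N -> l e v = 1.
  by move=> h2 h3; rewrite /l lN.
move=> /(_ h0 h1) h.
have /box_sum_neq0 [q [hq _ /cup_neq0 hc]] : box_sum N (enum I)
    (cup l (enum I) [set i in enum I]%SET) (fun=> 0%N) != 0.
  by rewrite h oner_neq0.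
exists q; split=> [i|e]; first by apply: hq; rewrite mem_enum.
have [|u [w [hu hw huw]]] := hc e; first by rewrite mem_enum.
exists u, w; split=> //; move: huw; rewrite /l; apply: contraNneq => ->.
by [].
Qed.

End Kuhn.

(** * The covering theorem for boxes *)

Section Box.
Variables (R : realType) (n : nat).
Local Open Scope ring_scope.
Implicit Types (x z l u : 'rV[R]_n).

Lemma nbhs_rowP x (A : set 'rV[R]_n) :
  nbhs x A <-> exists2 e : R, 0 < e &
    forall z, (forall i, `|z ord0 i - x ord0 i| < e) -> A z.
Proof.
rewrite -(filter_from_ballE x) /=; split=> -[e e0 h]; exists e => //.
  move=> z hz; apply: h; split=> // i j; rewrite (ord1 i) /ball /= distrC.
  exact: hz.
move=> z [_ hz]; apply: h => i; have := hz ord0 i.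
by rewrite /ball /= distrC.
Qed.

Definition box l u : set 'rV[R]_n :=
  [set z | forall i, l ord0 i <= z ord0 i <= u ord0 i].

Lemma compact_box l u : compact (box l u).
Proof.
have := @rV_compact R n (fun i => `[l ord0 i, u ord0 i]%classic)
  (fun i => @segment_compact _ _ _).
congr compact; apply/seteqP; split=> z /= h i; have := h i; rewrite /= in_itv //.
Qed.

(** On a fine grid, Kuhn's lemma yields a small cube on which every label takes both values. But the
    cube lies in one [U k], where label k is constantly false, or in one [V k], where it is
    constantly true. *)
Lemma box_not_separated l u (U V : 'I_n -> set 'rV[R]_n) :
  (forall k, l ord0 k < u ord0 k) ->
  (forall k z, box l u z -> U k z -> V k z -> False) ->
  (forall k z, box l u z -> z ord0 k = u ord0 k -> ~ U k z) ->
  (forall k z, box l u z -> z ord0 k = l ord0 k -> ~ V k z) ->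
  ~ (forall z, box l u z -> exists k,
      (\forall z' \near z, box l u z' -> U k z') \/
      (\forall z' \near z, box l u z' -> V k z')).
Proof.
move=> lu dUV hU hV cov.
(* A common bound for the side lengths; the summand 1 makes it positive in every dimension. The mesh
   of the grid is at most w/(N+1). *)
pose w := 1 + \sum_i (u ord0 i - l ord0 i).
have wi i : u ord0 i - l ord0 i <= w.
  rewrite /w (bigD1 i) //= addrCA lerDl addr_ge0 // sumr_ge0 // => j _.
  by rewrite subr_ge0 ltW.
have w0 : 0 < w by rewrite ltr_pwDl // sumr_ge0 // => j _; rewrite subr_ge0 ltW.
pose P (N : nat) x := exists k,
  (forall z, box l u z -> (forall i, `|z ord0 i - x ord0 i| <= w / N.+1%:R) -> U k z) \/
  (forall z, box l u z -> (forall i, `|z ord0 i - x ord0 i| <= w / N.+1%:R) -> V k z).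
(* A Lebesgue number: by compactness one mesh serves all points of the box. *)
have [N _ /(_ N (leqnn N)) /= hN] : \forall N \near \oo, box l u `<=` P N.
  apply: (iffLR (@compact_near_coveringP _ _) (@compact_box l u)) => x /cov[k hk].
  have nbP (W : set 'rV[R]_n) : (\forall z' \near x, box l u z' -> W z') ->
      \forall x' \near x & N \near \oo, forall z, box l u z ->
        (forall i, `|z ord0 i - (x' : 'rV[R]_n) ord0 i| <= w / N.+1%:R) -> W z.
    move=> /nbhs_rowP [e e0 he].
    have e2 : 0 < e / 2 / w by rewrite !divr_gt0.
    exists ([set x' : 'rV[R]_n | forall i, `|x' ord0 i - x ord0 i| < e / 2],
            [set N | N.+1%:R^-1 < e / 2 / w]) => /=.
      split; first by apply/nbhs_rowP; exists (e / 2) => //; rewrite divr_gt0.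
      exact: (near_infty_natSinv_lt (PosNum e2)).
    - move=> [x' N] /= [hx' hN] z Qz hz; apply: he => // i.
      rewrite -[z _ _](subrK (x' ord0 i)) -addrA (le_lt_trans (ler_normD _ _)) //.
      rewrite [e]splitr ler_ltD // (le_trans (hz i)) //.
      by move: hN; rewrite ltr_pdivlMr // mulrC => /ltW.
  by case: hk => /nbP; apply: filterS => y hy; exists k; [left|right].
pose M := N.+1.
pose g (v : 'I_n -> nat) : 'rV[R]_n :=
  \row_i (l ord0 i + (u ord0 i - l ord0 i) * ((v i)%:R / M%:R)).
have M0 : 0 < M%:R :> R by rewrite ltr0n.
have gQ v : (forall i, v i <= M)%N -> box l u (g v).
  move=> hv i; rewrite mxE.
  have h0 : 0 <= u ord0 i - l ord0 i by rewrite subr_ge0 ltW.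
  have h1 : 0 <= (v i)%:R / M%:R :> R by rewrite divr_ge0.
  have h2 : (v i)%:R / M%:R <= 1 :> R by rewrite ler_pdivrMr // mul1r ler_nat.
  rewrite lerDl mulr_ge0 //= -lerBrDl; exact: ler_piMr.
(* The second condition forces the label on the lower face, which [U e] need not contain. *)
pose lab (e : 'I_n) v := `[< ~ U e (g v) >] && (v e != 0%N).
have [e v _ ve|e v hv ve|q [hq hk]] := @kuhn _ M lab.
- by rewrite /lab ve andbF.
- rewrite /lab ve andbT; apply/asboolP; apply: hU; first exact: gQ.
  by rewrite mxE ve divff ?gt_eqF // mulr1 addrC subrK.
have qQ : box l u (g q) by apply: gQ => i; exact: ltnW.
have near_q v : (forall i, q i <= v i <= (q i).+1)%N ->
    box l u (g v) /\ forall i, `|g v ord0 i - g q ord0 i| <= w / N.+1%:R.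
  move=> hv; split.
    by apply: gQ => i; have := hq i; have := hv i; lia.
  move=> i; have /andP[h1 h2] := hv i.
  have -> : g v ord0 i - g q ord0 i =
      (u ord0 i - l ord0 i) * (v i - q i)%:R / M%:R.
    by rewrite !mxE natrB //; ring.
  have h0 : 0 <= u ord0 i - l ord0 i by rewrite subr_ge0 ltW.
  rewrite ger0_norm; last by rewrite divr_ge0 // mulr_ge0.
  rewrite ler_wpM2r ?invr_ge0 //; apply: le_trans (wi i); apply: ler_piMr => //.
  by rewrite -[1]/(1%:R) ler_nat; lia.
have [k [h|h]] := hN _ qQ; have [a [b [ha hb]]] := hk k.
  have [] := (near_q _ ha, near_q _ hb) => -[Qa a1] [Qb b1].
  rewrite /lab; have -> : `[< ~ U k (g a) >] = false by apply/asboolP => -[]; exact: h.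
  by have -> : `[< ~ U k (g b) >] = false by apply/asboolP => -[]; exact: h.
have lab1 v : (forall i, q i <= v i <= (q i).+1)%N -> lab k v.
  move=> /near_q[Qv v1]; apply/andP; split.
    by apply/asboolP => Uv; exact: (dUV k (g v) Qv Uv (h _ Qv v1)).
  apply/negP => /eqP vk; apply: (hV k (g v)) => //; last exact: h.
  by rewrite mxE vk mul0r mulr0 addr0.
by rewrite !lab1.
Qed.

End Box.

(** * Charts and invariance of the boundary *)

Section Charts.
Variables (R : realType) (n : nat).
Local Open Scope ring_scope.
Implicit Types (x z p q : 'rV[R]_n).

Lemma continuous_rowP (T : topologicalType) (f : T -> 'rV[R]_n) t :
  {for t, continuous f} <->
  forall e : R, 0 < e ->
    \forall s \near t, forall i, `|f s ord0 i - f t ord0 i| < e.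
Proof.
split=> [cf e e0|H W /nbhs_rowP[e e0 he]].
  apply: (cf [set z | forall i, `|z ord0 i - f t ord0 i| < e]).
  by apply/nbhs_rowP; exists e.
by have := H e e0; apply: filterS => s; exact: he.
Qed.

(* A homeomorphism of [E] onto [N], with [phi] extended to the whole Euclidean
   space and [gamma] extended arbitrarily outside [N]. *)
Definition chart (M : topologicalType) (E : set 'rV[R]_n) (N : set M)
    (phi : 'rV[R]_n -> M) (gamma : M -> 'rV[R]_n) :=
  [/\ continuous phi,
      forall m, N m -> E (gamma m) /\ phi (gamma m) = m,
      forall z, E z -> N (phi z) /\ gamma (phi z) = z &
      forall m, nbhs m N -> {for m, continuous gamma}].

Lemma set_valP (T : Type) (A : set T) (a : set_type A) : A (set_val a).
Proof. by case: a => a aA /=; exact: set_mem. Qed.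

(** [T] is a retract of the Euclidean space through [iota] and [rho], which covers the whole space
    and the half-space at once. Outside [N] the inverse takes the default value 0. *)
Lemma chart_of_homeomorphism (M T : topologicalType) (N : set M)
    (iota : T -> 'rV[R]_n) (rho : 'rV[R]_n -> T) (f : T -> set_type N) :
  continuous iota -> continuous rho -> cancel iota rho -> homeomorphism f ->
  exists gamma, chart (range iota) N (fun z => set_val (f (rho z))) gamma.
Proof.
move=> ci cr ir [cf [g [fK gK cg]]].
pose gamma m := if pselect (N m) is left h
  then iota (g (exist _ m (mem_set h))) else 0.
have gammaE (t : set_type N) : gamma (set_val t) = iota (g t).
  rewrite /gamma; case: pselect => [h|]; last by case; exact: set_valP.
  by congr (iota (g _)); apply: val_inj.
exists gamma; split.
- move=> z; apply: (@continuous_comp _ _ _ rho (set_val \o f)); first exact: cr.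
  apply: (@continuous_comp _ _ _ f set_val); first exact: cf.
  exact: initial_continuous.
- move=> m Nm; pose t : set_type N := exist _ m (mem_set Nm).
  rewrite -[m]/(set_val t) gammaE ir gK; split=> [|//].
  by exists (g t).
- move=> _ [t _ <-]; rewrite gammaE ir fK; split=> //; exact: set_valP.
- move=> m Nm W hW; have Nm' := nbhs_singleton Nm.
  pose t : set_type N := exist _ m (mem_set Nm').
  have ct : {for t, continuous (iota \o g)}.
    by apply: continuous_comp; [exact: cg|exact: ci].
  have : nbhs t ((iota \o g) @^-1` W).
    by apply: ct; rewrite /= -gammaE.
  case=> _ /= [] [G oG <-] /= Gt sub.
  have : nbhs m (G `&` N) by apply: filterI => //; exact: open_nbhs_nbhs.
  apply: filterS => y [Gy Ny].
  rewrite /= -[y]/(set_val (exist _ y (mem_set Ny) : set_type N)) gammaE.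
  exact: sub.
Qed.

Definition is_last (i : 'I_n) := i == n.-1 :> nat.

(** The retraction onto the half-space along the last axis. *)
Definition clamp z : 'rV[R]_n :=
  \row_i if is_last i then Num.max 0 (z ord0 i) else z ord0 i.

Lemma clamp_half z : half_space R n (clamp z).
Proof. by move=> i /eqP il; rewrite mxE /is_last il le_max lexx. Qed.

Lemma clamp_id z : half_space R n z -> clamp z = z.
Proof.
move=> hz; apply/rowP => i; rewrite mxE; case: ifP => // /eqP/hz h.
by apply/max_idPr.
Qed.

Lemma clamp_continuous : continuous clamp.
Proof.
move=> z; apply/continuous_rowP => e e0; apply/nbhs_rowP; exists e => // y hy i.
rewrite !mxE; apply: le_lt_trans (hy i); case: ifP => // _.
have h1 := ler_norm (y ord0 i - z ord0 i).
have h2 := ler_norm (z ord0 i - y ord0 i); rewrite distrC in h2.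
rewrite ler_norml /Num.max; case: (ltP 0 (y ord0 i)) => a0;
  case: (ltP 0 (z ord0 i)) => b0; apply/andP; split; lra.
Qed.

Lemma half_space_chart (M : topologicalType) (N : set M)
    (f : set_type (half_space R n) -> set_type N) : homeomorphism f ->
  exists phi gamma, chart (half_space R n) N phi gamma /\
    forall a : set_type (half_space R n), phi (set_val a) = set_val (f a).
Proof.
move=> hf; pose rho z : set_type (half_space R n) :=
  exist _ (clamp z) (mem_set (clamp_half z)).
have rK : cancel (@set_val _ (half_space R n)) rho.
  by move=> a; apply: val_inj => /=; apply: clamp_id; exact: set_valP.
have cr : continuous rho.
  by apply: continuous_comp_initial; exact: clamp_continuous.
have [gamma hg] := chart_of_homeomorphism (@initial_continuous _ _ _) cr rK hf.
exists (fun z => set_val (f (rho z))), gamma; split; last by move=> a; rewrite rK.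
suff <- : range (@set_val _ (half_space R n)) = half_space R n by [].
apply/seteqP; split => z; first by move=> [a _ <-]; exact: set_valP.
by move=> hz; exists (rho z) => //=; exact: clamp_id.
Qed.

Definition shift (d : R) z : 'rV[R]_n :=
  \row_i (if is_last i then z ord0 i + d else z ord0 i).

(* Translating in the chart around the boundary point moves the identity of a
   small cube slightly, to a map that misses the centre of the cube. *)
Lemma boundary_invariance (M : topologicalType) (N N' : set M)
    phi gamma phi' gamma' q p :
  (0 < n)%N ->
  chart (half_space R n) N phi gamma -> nbhs (phi q) N ->
  (forall i, is_last i -> 0 < q ord0 i) ->
  chart (half_space R n) N' phi' gamma' -> nbhs (phi q) N' ->
  half_space_bd R n p -> phi' p = phi q -> False.
Proof.
move=> n0 [cphi NE EN cgamma] Nq q0 [cphi' NE' EN' cgamma'] Nq' p0 pq.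
have {}n0 : (n.-1 < n)%N by rewrite ltn_predL.
pose il : 'I_n := Ordinal n0.
have ilP : is_last il by exact: eqxx.
have lastE i : is_last i -> i = il by move=> /eqP e; apply: val_inj.
pose O := (N `&` N')°.
have Oq : O (phi q) by apply: filterI.
have OP m : O m -> nbhs m N /\ nbhs m N' /\ nbhs m O.
  move=> Om; split; first by apply: filterS Om => ? [].
  split; first by apply: filterS Om => ? [].
  exact: open_nbhs_nbhs (conj (open_interior _) Om).
have /nbhs_rowP[h1 h10 hO] : nbhs q (phi @^-1` O).
  by apply: cphi; have [_ []] := OP _ Oq.
(* The first bound keeps the image of the cube in [O], the second keeps the cube in the
   half-space. *)
pose h := Num.min (h1 / 2) (q ord0 il).
have h0 : 0 < h by rewrite lt_min divr_gt0 // q0.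
have hh1 : h < h1 by rewrite gt_min; apply/orP; left; lra.
have hq : h <= q ord0 il by rewrite ge_min lexx orbT.
pose l : 'rV[R]_n := \row_i (q ord0 i - h).
pose u : 'rV[R]_n := \row_i (q ord0 i + h).
have boxO z : box l u z -> O (phi z) /\ half_space R n z.
  move=> hz; split.
    apply: hO => i; apply: le_lt_trans hh1.
    have := hz i; rewrite !mxE => /andP[a b]; rewrite ler_norml; lra.
  move=> i /eqP/lastE ->; have := hz il; rewrite !mxE => /andP[a _]; lra.
pose Psi d z := gamma (phi' (shift d (gamma' (phi z)))).
pose P d z := O (phi' (shift d (gamma' (phi z)))) /\
  forall i, `|Psi d z ord0 i - z ord0 i| < h.
have shift_near z (w : 'rV[R]_n) (e d : R) : 0 < d < e / 2 ->
    (forall i, `|z ord0 i - w ord0 i| < e / 2) ->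
    forall i, `|shift d z ord0 i - w ord0 i| < e.
  move=> /andP[d0 de] hz i; rewrite mxE; case: ifP => _.
    rewrite addrAC (le_lt_trans (ler_normD _ _)) // [e]splitr ltrD //.
    by rewrite gtr0_norm.
  by rewrite (lt_trans (hz i)) //; lra.
(* For d = 0 the map [Psi] is the identity on the box; continuity and compactness give one positive
   d for which it moves every point by less than h. *)
have [d [d0 hd]] : exists d : R, 0 < d /\ box l u `<=` P d.
  suff H : \forall d \near 0^'+, box l u `<=` P d.
    have [d [d0 hd]] : exists d : R, 0 < d /\ box l u `<=` P d.
      near (0:R)^'+ => d; exists d; split; first by near: d; exact: nbhs_right_gt.
      by near: d.
    by exists d.
  apply: (iffLR (@compact_near_coveringP _ _) (@compact_box _ _ l u)) => z0 Qz0.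
  have [Oz0 Hz0] := boxO z0 Qz0.
  have [N1 [N1' O1]] := OP _ Oz0.
  have phi'K : phi' (gamma' (phi z0)) = phi z0.
    by have [] := NE' _ (nbhs_singleton N1').
  have gammaK : gamma (phi z0) = z0 by have [] := EN _ Hz0.
  have h2 : 0 < h / 2 by rewrite divr_gt0.
  have A1 : \forall m \near phi z0, forall i,
      `|gamma m ord0 i - z0 ord0 i| < h / 2.
    by have := iffLR (continuous_rowP _ _) (cgamma _ N1) _ h2; rewrite gammaK.
  have A2 : \forall w \near gamma' (phi z0), O (phi' w) /\
     forall i, `|gamma (phi' w) ord0 i - z0 ord0 i| < h / 2.
    apply: (cphi' (gamma' (phi z0)) [set m | O m /\
      forall i, `|gamma m ord0 i - z0 ord0 i| < h / 2]).
    by rewrite phi'K; apply: filterI.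
  have /nbhs_rowP[e e0 he] := A2.
  have e2 : 0 < e / 2 by rewrite divr_gt0.
  have cc : {for z0, continuous (fun z => gamma' (phi z))}.
    by apply: (@continuous_comp _ _ _ phi gamma'); [exact: cphi|exact: cgamma'].
  exists ([set z : 'rV[R]_n | (forall i,
        `|gamma' (phi z) ord0 i - gamma' (phi z0) ord0 i| < e / 2) /\
        forall i, `|z ord0 i - z0 ord0 i| < h / 2],
      [set d : R | 0 < d < e / 2]) => /=.
    split.
      apply: filterI; first exact: (iffLR (continuous_rowP _ _) cc).
      by apply/nbhs_rowP; exists (h / 2).
    by near=> d; apply/andP; split; near: d;
      [exact: nbhs_right_gt|exact: nbhs_right_lt].
  move=> [z d] /= [[hz hz'] hd]; have [h3 h4] := he _ (shift_near _ _ _ _ hd hz).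
  split=> // i; rewrite -[_ - _](subrKA (z0 ord0 i)).
  rewrite (le_lt_trans (ler_normD _ _)) // [h]splitr ltrD //; last by rewrite distrC.
(* The faces lie at distance h from the centre, so [Psi] stays on the right side of [q] on each of
   them; the sets cover the box because [Psi] misses [q]. *)
apply: (@box_not_separated _ _ l u (fun k => [set z | Psi d z ord0 k < q ord0 k])
  (fun k => [set z | q ord0 k < Psi d z ord0 k])).
- by move=> k; rewrite !mxE; clear hd; lra.
- by move=> k z _ /= a b; have := lt_trans a b; rewrite ltxx.
- move=> k z Qz zk /= a; have [_ /(_ k)] := hd z Qz.
  by rewrite zk !mxE ltr_norml => /andP[]; clear hd; lra.
- move=> k z Qz zk /= a; have [_ /(_ k)] := hd z Qz.
  by rewrite zk !mxE ltr_norml => /andP[]; clear hd; lra.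
move=> z Qz; have [Oz Hz] := boxO z Qz; have [OPz _] := hd z Qz.
(* If [Psi d z] were [q], the shifted point would be [p] by injectivity of the second chart; but its
   last coordinate is at least d, while that of [p] is 0. *)
have [k hk] : exists k, Psi d z ord0 k != q ord0 k.
  apply: contrapT => /forallNP H.
  have e : Psi d z = q.
    apply/rowP => k; apply: contrapT => /eqP; exact: H.
  have Eq : half_space R n q.
    by move=> i /eqP/q0/ltW.
  have [/nbhs_singleton Nw [/nbhs_singleton Nw' _]] := OP _ OPz.
  have [_ phiw] := NE _ Nw; rewrite -/(Psi d z) e in phiw.
  have [/nbhs_singleton Nz [/nbhs_singleton Nz' _]] := OP _ Oz.
  have [Eg _] := NE' _ Nz'.
  have Es : half_space R n (shift d (gamma' (phi z))).
    by move=> i ie; rewrite mxE /is_last ie eqxx addr_ge0 ?(ltW d0) // Eg.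
  have Ep : half_space R n p by move=> i /p0 ->.
  have [_ e1] := EN' _ Es; have [_ e2] := EN' _ Ep.
  have := p0 il erefl; rewrite -e2 pq phiw e1 mxE ilP => e3.
  by have := Eg il erefl; clear hd; lra.
have [_ [Nz' _]] := OP _ Oz; have [Nw [_ _]] := OP _ OPz.
have cPsi : {for z, continuous (Psi d)}.
  apply: (@continuous_comp _ _ _ (fun z => phi' (shift d (gamma' (phi z)))) gamma);
    last exact: cgamma.
  apply: (@continuous_comp _ _ _ (fun z => shift d (gamma' (phi z))) phi');
    last exact: cphi'.
  apply: (@continuous_comp _ _ _ (fun z => gamma' (phi z)) (shift d)).
    apply: (@continuous_comp _ _ _ phi gamma'); [exact: cphi|exact: cgamma'].
  apply/continuous_rowP => e e0; apply/nbhs_rowP; exists e => // y hy i.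
  rewrite !mxE; case: ifP => _; last exact: hy.
  by rewrite opprD addrACA subrr addr0; exact: hy.
exists k; have e0 : 0 < `|Psi d z ord0 k - q ord0 k| by rewrite normr_gt0 subr_eq0.
have := iffLR (continuous_rowP _ _) cPsi _ e0.
move: hk; rewrite neq_lt => /orP[hk|hk] near_z; [left|right];
    apply: filterS near_z => y /(_ k) /= + _.
  rewrite ltr_norml (ltr0_norm (_ : _ - _ < 0)) ?subr_lt0 // => /andP[_].
  by clear hd; lra.
rewrite ltr_norml (gtr0_norm (_ : 0 < _ - _)) ?subr_gt0 // => /andP[+ _].
by clear hd; lra.
Unshelve. all: by end_near. Qed.

End Charts.

(** * Formal disjointness *)

Section ReflexiveTransitiveClosure.
Variable C : set (nat * nat).

Inductive rtc : nat -> nat -> Prop :=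
| rtc_refl i : rtc i i
| rtc_step i j k : C (i, j) -> rtc j k -> rtc i k.

Lemma rtc_trans i j k : rtc i j -> rtc j k -> rtc i k.
Proof. by elim=> // a b c ab _ IH /IH; exact: rtc_step. Qed.

(** Entry [t] of the sequence coded by [w] as nested pairs, with head [cfst] and tail [csnd]; a
    chain of formal inclusions thus becomes a single number to search for. *)
Definition centry t w := cfst (iter t csnd w).

Lemma rtc_codeP i k : rtc i k <-> exists m, exists w,
  (centry 0 w = i /\ centry m w = k) /\
  forall t, t < m -> C (centry t w, centry t.+1 w).
Proof.
split.
  elim=> [a|a b c ab _ [m [w [[w0 wm] wC]]]].
    by exists 0, (cpair a 0); rewrite /centry /= cpairK1.
  have centryS t : centry t.+1 (cpair a w) = centry t w.
    by rewrite /centry iterSr cpairK2.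
  exists m.+1, (cpair a w); rewrite centryS; split.
    by rewrite /centry /= cpairK1.
  move=> [_|t tm]; rewrite !centryS; last exact: wC.
  by rewrite {1}/centry /= cpairK1 w0.
move=> [m [w [[<- <-] wC]]].
elim: m w wC => [|m IH] w wC; first exact: rtc_refl.
have centryS t : centry t.+1 w = centry t (csnd w) by rewrite /centry iterSr.
apply: rtc_step (wC 0 isT) _; rewrite !centryS; apply: IH => t tm.
by rewrite -!centryS; exact: wC.
Qed.

Lemma computable_centry t w : computable_fun t -> computable_fun w ->
  computable_fun (fun z => centry (t z) (w z)).
Proof.
move=> ht hw; apply: computable_cfst.
have -> : (fun z => iter (t z) csnd (w z)) =
    (fun z => nrec id (fun y => csnd (cfst (csnd y))) (t z) (w z)).
  apply: funext => z; elim: (t z) => //= m ->.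
  by rewrite cpairK2 cpairK1.
apply: computable_nrec => //; first exact: computable_id.
exact/computable_csnd/computable_cfst/computable_csnd/computable_id.
Qed.

Lemma sigma1_rtc f g : ce_set2 C -> computable_fun f -> computable_fun g ->
  sigma1 (fun z => rtc (f z) (g z)).
Proof.
move=> hC hf hg.
have h0 : computable_fun id := computable_id.
apply: (sigma1_ext (fun z => iff_sym (rtc_codeP (f z) (g z)))).
apply: sigma1_ex; apply: sigma1_ex.
have h1 := computable_cfst h0; have h2 := computable_csnd h0.
have h12 := computable_csnd h2; have h11 := computable_cfst h2.
apply: sigma1_and.
  apply: sigma1_and; apply: dec_sigma1; apply: dec_eq.
  - by apply: computable_centry => //; exact: computable_const.
  - exact: computable_comp.
  - exact: computable_centry.
  - exact: computable_comp.
apply: sigma1_forall_lt => //; apply: ce_sigma1_2 => //.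
  by apply: computable_centry => //; exact: computable_cfst.
apply: computable_centry; last exact: computable_cfst.
exact: computable_succ.
Qed.

End ReflexiveTransitiveClosure.

(** * Induction on compact sets *)

Section Compactness.
Variable X : topologicalType.

(** The families of sets that contain all supersets of some set with [Q] form a filter, since [Q]
    passes to unions; compactness in its near-covering form is applied to it. *)
Lemma compact_ind (Q : set X -> Prop) (K : set X) : compact K -> Q set0 ->
  (forall A B, Q A -> Q B -> Q (A `|` B)) ->
  (forall A B, A `<=` B -> Q B -> Q A) ->
  (forall x, K x -> exists2 U, nbhs x U & Q U) -> Q K.
Proof.
move=> cK Q0 QU QS Ql.
pose F := filter_from Q (fun A => [set B | A `<=` B]).
have FF : Filter F.
  apply: filter_from_filter; first by exists set0.
  move=> A B QA QB; exists (A `|` B); first exact: QU.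
  by move=> D /= ABD; split=> x h; apply: ABD; [left|right].
have [x /Ql[U xU QU']|A QA sA] :=
    iffLR (compact_near_coveringP K) cK _ F (fun B x => B x) FF.
  exists (U, [set B | U `<=` B]) => /=; first by split=> //; exists U.
  by move=> [y B] [/= Uy UB]; exact: UB.
by apply: QS QA; exact: (sA A).
Qed.

End Compactness.

(** * Formally disjoint covers of compact sets *)

Section FormalDisjointness.
Variables (X : topologicalType) (I : nat -> set X) (C D : set (nat * nat)).
Hypotheses (Ib : basis (range I))
  (DP : forall i j, D (i, j) -> I i `&` I j = set0)
  (CP : forall i j, C (i, j) -> I i `<=` I j)
  (sepP : forall x y, x <> y -> exists i j, [/\ I i x, I j y & D (i, j)])
  (refineP : forall x i j, (I i `&` I j) x ->
     exists k, [/\ I k x, C (k, i) & C (k, j)]).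

Definition seq_union (s : seq nat) : set X := [set x | exists2 i, i \in s & I i x].

Lemma basis_open i : open (I i).
Proof. by have [h _] := Ib; apply: h; exists i. Qed.

Lemma seq_union_cat s t : seq_union (s ++ t) = seq_union s `|` seq_union t.
Proof.
apply/seteqP; split=> x.
  by move=> [i]; rewrite mem_cat => /orP[] h Ix; [left|right]; exists i.
by move=> [] [i h Ix]; exists i; rewrite // mem_cat h ?orbT.
Qed.

Lemma basis_cover x : exists i, I i x.
Proof.
have [_ h] := Ib; have [_ [[i _ <-] Ix] _] := h x setT filterT.
by exists i.
Qed.

Lemma rtc_sub i j : rtc C i j -> I i `<=` I j.
Proof. by elim=> [k|a b c /CP ab _ bc] x // /ab; exact: bc. Qed.

(** Disjointness certified by [D] after formal enlargement of both sets; it is inherited by formally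
    smaller sets and remains semidecidable. *)
Definition fdisj i j := exists i', exists j',
  (rtc C i i' /\ rtc C j j') /\ D (i', j').

Lemma fdisjP i j x : fdisj i j -> I i x -> I j x -> False.
Proof.
move=> [i' [j' [[ii' jj'] /DP e]]] ix jx.
by have : (I i' `&` I j') x; [split; exact: rtc_sub ix || exact: rtc_sub jx|rewrite e].
Qed.

Lemma fdisjS i j i' j' : rtc C i i' -> rtc C j j' -> fdisj i' j' -> fdisj i j.
Proof.
move=> ii' jj' [a [b [[h1 h2] h3]]]; exists a, b; split=> //.
by split; [exact: rtc_trans h1|exact: rtc_trans h2].
Qed.

Lemma sigma1_fdisj f g : ce_set2 C -> ce_set2 D ->
  computable_fun f -> computable_fun g -> sigma1 (fun z => fdisj (f z) (g z)).
Proof.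
move=> hC hD hf hg.
have h0 : computable_fun id := computable_id.
have h1 := computable_cfst h0; have h2 := computable_csnd h0.
have h11 := computable_cfst h2; have h12 := computable_csnd h2.
apply: sigma1_ex; apply: sigma1_ex; apply: sigma1_and.
  by apply: sigma1_and; apply: sigma1_rtc => //; exact: computable_comp.
exact: ce_sigma1_2.
Qed.

Lemma computable_space_hausdorff : hausdorff_space X.
Proof.
move=> x y cxy; apply: contrapT => /sepP [i [j [Ix Iy /DP e]]].
have := cxy (I i) (I j); rewrite e => -[||z []//];
  by apply: open_nbhs_nbhs; split=> //; exact: basis_open.
Qed.

Lemma refine_pt x (s : seq nat) : (forall i, i \in s -> I i x) ->
  exists2 k, I k x & forall i, i \in s -> rtc C k i.
Proof.
elim: s => [|a s IH] h; first by have [k] := basis_cover x; exists k.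
have [i si|k kx ks] := IH; first by apply: h; rewrite inE si orbT.
have [|l [lx lk la]] := @refineP x k a; first by split=> //; apply: h; rewrite mem_head.
exists l => // i; rewrite inE => /orP[/eqP ->|/ks ki].
  exact: rtc_step la (rtc_refl _ _).
exact: rtc_step lk ki.
Qed.

Lemma cover_seq K : compact K -> exists s, K `<=` seq_union s.
Proof.
move=> cK; apply: (compact_ind (Q := fun A => exists s, A `<=` seq_union s) cK).
- by exists [::].
- move=> A B [s hs] [t ht]; exists (s ++ t); rewrite seq_union_cat.
  exact: setUSS.
- by move=> A B AB [s Bs]; exists s; exact: subset_trans AB Bs.
move=> x _; have [i ix] := basis_cover x; exists (I i).
  by apply: open_nbhs_nbhs; split=> //; exact: basis_open.
by exists [:: i] => y iy; exists i => //; rewrite inE.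
Qed.

Lemma refine_seq K s t : compact K -> K `<=` seq_union s -> K `<=` seq_union t ->
  exists2 r, K `<=` seq_union r & forall k, k \in r ->
    (exists2 i, i \in s & rtc C k i) /\ (exists2 i, i \in t & rtc C k i).
Proof.
move=> cK Ks Kt.
apply: (compact_ind (Q := fun A => exists2 r, A `<=` seq_union r & forall k, k \in r ->
    (exists2 i, i \in s & rtc C k i) /\ (exists2 i, i \in t & rtc C k i)) cK).
- by exists [::].
- move=> A B [r1 h1 g1] [r2 h2 g2]; exists (r1 ++ r2).
    by rewrite seq_union_cat; exact: setUSS.
  by move=> k; rewrite mem_cat => /orP[/g1|/g2].
- by move=> A B AB [r Br h]; exists r => //; exact: subset_trans AB Br.
move=> x Kx; have [i si ix] := Ks x Kx; have [j tj jx] := Kt x Kx.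
have [|k kx kij] := @refine_pt x [:: i; j].
  by move=> l; rewrite !inE => /orP[] /eqP ->.
exists (I k); first by apply: open_nbhs_nbhs; split=> //; exact: basis_open.
exists [:: k]; first by move=> y ky; exists k => //; rewrite inE.
move=> l; rewrite inE => /eqP ->.
by split; [exists i|exists j] => //; apply: kij; rewrite !inE eqxx ?orbT.
Qed.

Definition seq_fdisj (s t : seq nat) := forall i j, i \in s -> j \in t -> fdisj i j.

Lemma separate_pt x L : compact L -> ~ L x ->
  exists k t, [/\ I k x, L `<=` seq_union t & seq_fdisj [:: k] t].
Proof.
move=> cL nLx.
suff : exists k t, [/\ I k x, L `<=` seq_union t & seq_fdisj [:: k] t] by [].
have {}nLx : L `<=` [set y | x <> y] by move=> y Ly xy; apply: nLx; rewrite xy.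
apply: (compact_ind (Q := fun A => exists k t,
  [/\ I k x, A `<=` seq_union t & seq_fdisj [:: k] t]) cL).
- by have [k kx] := basis_cover x; exists k, [::]; split=> [//|//|i j _].
- move=> A B [k [s [kx As ks]]] [l [t [lx Bt lt]]].
  have [|m mx mkl] := @refine_pt x [:: k; l].
    by move=> i; rewrite !inE => /orP[] /eqP ->.
  exists m, (s ++ t); split=> //; first by rewrite seq_union_cat; exact: setUSS.
  move=> i j; rewrite inE mem_cat => /eqP -> /orP[js|jt].
    apply: fdisjS (mkl k _) (rtc_refl _ _) (ks _ _ _ js); by rewrite ?inE ?eqxx.
  by apply: fdisjS (mkl l _) (rtc_refl _ _) (lt _ _ _ jt); rewrite ?inE ?eqxx ?orbT.
- by move=> A B AB [k [t [kx Bt kt]]]; exists k, t; split=> //; exact: subset_trans AB Bt.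
move=> y Ly; have [i [j [ix jy Dij]]] := sepP (nLx _ Ly).
exists (I j); first by apply: open_nbhs_nbhs; split=> //; exact: basis_open.
exists i, [:: j]; split=> //; first by move=> z jz; exists j => //; rewrite inE.
move=> a b; rewrite !inE => /eqP -> /eqP ->.
by exists i, j; split=> //; split; exact: rtc_refl.
Qed.

(** The formal version of separating compact sets in a Hausdorff space. In the union step the two
    covers of [L] are replaced by a common refinement, to which formal disjointness passes. *)
Lemma separate K L : compact K -> compact L -> (forall x, K x -> ~ L x) ->
  exists s t, [/\ K `<=` seq_union s, L `<=` seq_union t & seq_fdisj s t].
Proof.
move=> cK cL KL; apply: (compact_ind (Q := fun A => exists s t,
  [/\ A `<=` seq_union s, L `<=` seq_union t & seq_fdisj s t]) cK).
- by have [t Lt] := cover_seq cL; exists [::], t; split=> [//|//|i j].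
- move=> A B [s1 [t1 [As1 Lt1 d1]]] [s2 [t2 [As2 Lt2 d2]]].
  have [t Lt tP] := refine_seq cL Lt1 Lt2.
  exists (s1 ++ s2), t; split=> //; first by rewrite seq_union_cat; exact: setUSS.
  move=> i j; rewrite mem_cat => + /tP[[j1 j1t jj1] [j2 j2t jj2]].
  move=> /orP[is1|is2].
    exact: fdisjS (rtc_refl _ _) jj1 (d1 _ _ is1 j1t).
  exact: fdisjS (rtc_refl _ _) jj2 (d2 _ _ is2 j2t).
- move=> A B AB [s [t [Bs Lt d]]]; exists s, t; split=> //; exact: subset_trans AB Bs.
move=> x /KL /(separate_pt cL) [k [t [kx Lt d]]]; exists (I k).
  by apply: open_nbhs_nbhs; split=> //; exact: basis_open.
by exists [:: k], t; split=> // y ky; exists k => //; rewrite inE.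
Qed.

End FormalDisjointness.

(** * Enumeration near a point *)

Lemma sigma1_true : sigma1 (fun=> True).
Proof. by exists (fun=> 0); [exact: computable_const|split=> // _; exists 0]. Qed.

Lemma sigma1_false : sigma1 (fun=> False).
Proof. by exists (fun=> 1); [exact: computable_const|split=> // -[]]. Qed.

Lemma sigma1_forall_in (T : eqType) (s : seq T) (P : T -> nat -> Prop) :
  (forall t, sigma1 (P t)) -> sigma1 (fun z => forall t, t \in s -> P t z).
Proof.
move=> hP; elim: s => [|a s IH].
  by apply: sigma1_ext sigma1_true => z; split.
apply: sigma1_ext (sigma1_and (hP a) IH) => z; split.
  by move=> [Pa Ps] t; rewrite inE => /orP[/eqP -> //|/Ps].
by move=> h; split=> [|t ts]; apply: h; rewrite inE ?eqxx // ts orbT.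
Qed.

Lemma sigma1_forall_fin (T : finType) (P : T -> nat -> Prop) :
  (forall t, sigma1 (P t)) -> sigma1 (fun z => forall t, P t z).
Proof.
move=> /(sigma1_forall_in (enum T)); apply: sigma1_ext => z.
by split=> h t; [apply: h; rewrite mem_enum|].
Qed.

Lemma sigma1_mem_seq f (s : seq nat) :
  computable_fun f -> sigma1 (fun z => f z \in s).
Proof.
move=> hf; elim: s => [|a s IH]; first by apply: sigma1_ext sigma1_false.
have h := dec_sigma1 (dec_eq hf (computable_const a)).
apply: sigma1_ext (sigma1_or h IH) => z; rewrite inE; split.
  by move=> [->|->]; rewrite ?eqxx ?orbT.
by move=> /orP[/eqP|]; [left|right].
Qed.

Lemma sigma1_if (b : bool) P : (b -> sigma1 P) -> sigma1 (fun z => b -> P z).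
Proof.
case: b => hP; last by apply: sigma1_ext sigma1_true => z; split.
by apply: sigma1_ext (hP isT) => z; split=> // h; exact: h.
Qed.

Ltac computable := repeat first
  [ assumption | exact: computable_id | exact: computable_const
  | apply: computable_cfst | apply: computable_csnd | apply: computable_pair
  | apply: computable_add ].

(** * Detecting inside one chart the basic sets that meet S *)

Section Local.
Variables (R : realType) (br : nat -> set nat) (X : topologicalType)
  (I : nat -> set X) (n : nat) (C D : set (nat * nat)).
Hypotheses (hbr : finite_set_coding br) (Ib : basis (range I))
  (hC : ce_set2 C) (hD : ce_set2 D)
  (DP : forall i j, D (i, j) -> I i `&` I j = set0)
  (CP : forall i j, C (i, j) -> I i `<=` I j)
  (sepP : forall x y, x <> y -> exists i j, [/\ I i x, I j y & D (i, j)])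
  (refineP : forall x i j, (I i `&` I j) x ->
     exists k, [/\ I k x, C (k, i) & C (k, j)])
  (n0 : 0 < n).
Variables (S Sb : set X) (b : bool).
Hypotheses (cS : compact S) (hS : ce_set [set j | S `<=` finite_union br I j])
  (cSb : b -> compact Sb)
  (hSb : b -> ce_set [set j | Sb `<=` finite_union br I j]).

Notation fdisj := (fdisj C D).

(* [j] codes the finite relation formed by the [cpair k q] such that the basic
   set [q] belongs to the lower family [k], if [k < n], or to the upper family
   [k - n], if [n <= k < n + n]. *)
Definition detected (sc : seq nat) (al be : 'I_n -> seq nat) (i : nat) :=
  exists j,
  ((exists m, S `<=` finite_union br I m /\ forall q, br m q ->
      q = i \/ q \in sc \/ exists k, k.+1 <= n + n /\ br j (cpair k q)) /\
   (forall w, br j w -> forall w', br j w' ->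
      n <= cfst w \/ cfst w' <> n + cfst w \/ fdisj (csnd w) (csnd w'))) /\
  ((forall k : 'I_n, forall q, q \in be k -> forall w, br j w ->
      cfst w <> k \/ fdisj (csnd w) q) /\
   (forall k : 'I_n, forall q, q \in al k -> forall w, br j w ->
      cfst w <> n + k \/ fdisj (csnd w) q)) /\
  (b -> exists e, Sb `<=` finite_union br I e /\ forall w, br j w ->
      forall q, br e q -> cfst w <> n + n.-1 \/ fdisj (csnd w) q).

Lemma sigma1_detected sc al be : sigma1 (detected sc al be).
Proof.
have neq f g : computable_fun f -> computable_fun g ->
    sigma1 (fun z => f z <> g z).
  by move=> hf hg; apply: dec_sigma1; apply: dec_not; exact: dec_eq.
have fd f g : computable_fun f -> computable_fun g ->
  sigma1 (fun z => fdisj (f z) (g z)) by exact: sigma1_fdisj.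
apply: sigma1_ex; apply: sigma1_and; last apply: sigma1_and.
- apply: sigma1_and.
    apply: sigma1_ex; apply: sigma1_and.
      by apply: (sigma1_comp (ce_sigma1 hS)); computable.
    apply: (sigma1_forall_mem hbr); last by computable.
    apply: sigma1_or; first by apply: dec_sigma1; apply: dec_eq; computable.
    apply: sigma1_or; first by apply: sigma1_mem_seq; computable.
    apply: sigma1_ex; apply: sigma1_and; apply: dec_sigma1.
      by apply: dec_leq; [apply: computable_succ|]; computable.
    by apply: (dec_mem hbr); computable.
  apply: (sigma1_forall_mem hbr); last by computable.
  apply: (sigma1_forall_mem hbr); last by computable.
  apply: sigma1_or; first by apply: dec_sigma1; apply: dec_leq; computable.
  by apply: sigma1_or; [apply: neq|apply: fd]; computable.
- apply: sigma1_and; apply: sigma1_forall_fin => k; apply: sigma1_forall_in => q;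
    (apply: (sigma1_forall_mem hbr); last by computable);
    by apply: sigma1_or; [apply: neq|apply: fd]; computable.
apply: sigma1_if => /hSb h; apply: sigma1_ex; apply: sigma1_and.
  by apply: (sigma1_comp (ce_sigma1 h)); computable.
apply: (sigma1_forall_mem hbr); last by computable.
apply: (sigma1_forall_mem hbr); last by computable.
by apply: sigma1_or; [apply: neq|apply: fd]; computable.
Qed.

Variables (F : 'rV[R]_n -> X) (p : 'rV[R]_n) (h : R).
Local Open Scope ring_scope.

(* The flag [b] marks a half-space chart, with [p] on the boundary; [cell r] is
   then a half-cube. *)
Definition cell (r : R) : set 'rV[R]_n :=
  box (\row_k (p ord0 k - (if b && is_last k then 0 else r)))
      (\row_k (p ord0 k + r)).

Hypotheses (cF : continuous F) (h0 : 0 < h)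
  (FS : forall z, cell (h * 2) z -> S (F z))
  (Finj : forall z z', cell (h * 2) z -> cell (h * 2) z' -> F z = F z' -> z = z')
  (cT : compact (S `\` F @` [set z | cell (h * 2) z /\
     forall k, `|z ord0 k - p ord0 k| < h * 2]))
  (Sb1 : b -> forall z, cell (h * 2) z ->
     (forall k, is_last k -> z ord0 k = p ord0 k) -> Sb (F z))
  (Sb2 : b -> forall z, cell (h * 2) z ->
     (forall k, is_last k -> p ord0 k < z ord0 k) -> ~ Sb (F z)).

Lemma cell_dist r z k : 0 < r -> cell r z -> `|z ord0 k - p ord0 k| <= r.
Proof.
move=> r0 /(_ k); rewrite !mxE ler_norml => /andP[].
by case: ifP => _ h1 h2; apply/andP; split; lra.
Qed.

Lemma cellS r z : 0 < r -> r <= h * 2 -> cell r z -> cell (h * 2) z.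
Proof.
move=> r0 rh hz k; have := hz k; rewrite !mxE => /andP[].
by case: ifP => _ h1 h2; apply/andP; split; lra.
Qed.

Let cell_half z : cell h z -> cell (h * 2) z.
Proof. by apply: cellS => //; have := h0; lra. Qed.

Let closed_coord_le (k : 'I_n) (c : R) : closed [set z : 'rV[R]_n | z ord0 k <= c].
Proof.
have := @closed_comp _ _ (fun z : 'rV[R]_n => z ord0 k) [set x : R | x <= c].
apply; last exact: closed_le.
by move=> z _; exact: coord_continuous.
Qed.

Let closed_coord_ge (k : 'I_n) (c : R) : closed [set z : 'rV[R]_n | c <= z ord0 k].
Proof.
have := @closed_comp _ _ (fun z : 'rV[R]_n => z ord0 k) [set x : R | c <= x].
apply; last exact: closed_ge.
by move=> z _; exact: coord_continuous.
Qed.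

Let compact_image r A : closed A -> compact (F @` (cell r `&` A)).
Proof.
move=> clA; apply: continuous_compact; first exact: continuous_subspaceT.
by apply: compact_closedI => //; exact: compact_box.
Qed.

Let sep := @separate _ _ _ _ Ib sepP refineP.

(** If [I i] missed S, the coded families, pulled back along [F], would cover the cell, since [sc]
    stays away from it. The lower families avoid the upper faces, covered by [be], and the upper
    families avoid the lower faces, covered by [al] or, at the bottom of a half-cube, contained in
    [Sb]. This contradicts [box_not_separated]. *)
Lemma detected_meets sc al be :
  (forall z, cell h z -> ~ seq_union I sc (F z)) ->
  (forall k z, cell h z -> z ord0 k = p ord0 k + h -> seq_union I (be k) (F z)) ->
  (forall k z, cell h z -> z ord0 k = p ord0 k - h -> seq_union I (al k) (F z)) ->
  forall i, detected sc al be i -> I i `&` S !=set0.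
Proof.
move=> hsc hbe hal i [j [[[m [Sm mP]] c2] [[c3 c4] c5]]].
apply: contrapT => nI; have {}nI x : I i x -> S x -> False.
  by move=> Ix Sx; apply: nI; exists x.
have hS2 := cell_half.
pose U (k : nat) : set 'rV[R]_n := [set z | exists2 q, br j (cpair k q) & I q (F z)].
apply: (@box_not_separated _ _ (\row_k (p ord0 k - (if b && is_last k then 0 else h)))
   (\row_k (p ord0 k + h)) (fun k => U k) (fun k => U (n + k)%N)).
- by move=> k; rewrite !mxE; have := h0; case: ifP => _; lra.
- move=> k z _ [q jq Iq] [q' jq' Iq'].
  have := c2 _ jq _ jq'; rewrite !(cpairK1, cpairK2) => -[|[//|d]].
    by have := ltn_ord k; lia.
  exact: fdisjP DP CP _ _ _ d Iq Iq'.
- move=> k z Qz zk [q jq Iq].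
  have [q' q'be Iq'] : seq_union I (be k) (F z) by apply: hbe => //; rewrite zk mxE.
  have := c3 k _ q'be _ jq; rewrite !(cpairK1, cpairK2) => -[//|d].
  exact: fdisjP DP CP _ _ _ d Iq Iq'.
- move=> k z Qz; rewrite mxE; case: ifP => [/andP[bT kl]|_] zk [q jq Iq].
    have [e [Se eP]] := c5 bT.
    have [q' eq' Iq'] : finite_union br I e (F z).
      apply: Se; apply: Sb1 => //; first exact: hS2.
      by move=> k' /eqP kl'; rewrite (_ : k' = k) ?zk ?subr0 //; apply: val_inj;
         rewrite /= kl' (eqP kl).
    have := eP _ jq _ eq'; rewrite !(cpairK1, cpairK2) (eqP kl) => -[//|d].
    exact: fdisjP DP CP _ _ _ d Iq Iq'.
  have [q' q'be Iq'] : seq_union I (al k) (F z) by exact: hal.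
  have := c4 k _ q'be _ jq; rewrite !(cpairK1, cpairK2) => -[//|d].
  exact: fdisjP DP CP _ _ _ d Iq Iq'.
move=> z Qz; have [q mq Iq] := Sm _ (FS (hS2 _ Qz)).
have near_q : \forall z' \near z, I q (F z').
  by apply: cF; apply: open_nbhs_nbhs; split=> //; exact: basis_open.
have [qi|[qs|[k [kn jq]]]] := mP _ mq.
- by case: (nI (F z)); [rewrite -qi|exact/FS/hS2].
- by case: (hsc _ Qz); exists q.
have [kn'|nk] := ltnP k n.
  by exists (Ordinal kn'); left; apply: filterS near_q => z' ? _; exists q.
have kn' : (k - n < n)%N by lia.
exists (Ordinal kn'); right; apply: filterS near_q => z' ? _; exists q => //=.
by rewrite subnKC.
Qed.

(** A cube of radius e around [y] is mapped into [I i]; the rest of the cell is covered by the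
    compact sets [lower k] and [upper k]. As [y] is within h/2 of the centre, these lie in the
    regions already separated from the faces. *)
Lemma meets_detected sc al be :
  S `\` F @` [set z | cell (h * 2) z /\
    forall k, `|z ord0 k - p ord0 k| < h * 2] `<=` seq_union I sc ->
  (forall k, exists s, F @` (cell (h * 2) `&` [set z | z ord0 k <= p ord0 k + h / 2])
     `<=` seq_union I s /\ seq_fdisj C D s (be k)) ->
  (forall k, exists s, F @` (cell (h * 2) `&` [set z | p ord0 k - h / 2 <= z ord0 k])
     `<=` seq_union I s /\ seq_fdisj C D s (al k)) ->
  forall i y, cell (h * 2) y -> (forall k, `|y ord0 k - p ord0 k| < h / 2) ->
    I i (F y) -> detected sc al be i.
Proof.
move=> hsc hbe hal i y Qy yp Iy.
have /nbhs_rowP[e e0 he] : nbhs y (F @^-1` I i).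
  by apply: cF; apply: open_nbhs_nbhs; split=> //; exact: basis_open.
pose lower k := F @` (cell (h * 2) `&` [set z | z ord0 k <= y ord0 k - e]).
pose upper k := F @` (cell (h * 2) `&` [set z | y ord0 k + e <= z ord0 k]).
have cl k : compact (lower k).
  exact: compact_image (@closed_coord_le _ _).
have cu k : compact (upper k).
  exact: compact_image (@closed_coord_ge _ _).
have : forall k, exists ab : seq nat * seq nat,
    [/\ lower k `<=` seq_union I ab.1, upper k `<=` seq_union I ab.2,
        seq_fdisj C D ab.1 ab.2, seq_fdisj C D ab.1 (be k) &
        seq_fdisj C D ab.2 (al k) /\ (b && is_last k -> exists2 c,
          Sb `<=` seq_union I c & seq_fdisj C D ab.2 c)].
  move=> k; have [s1 [t1 [ls1 ut1 d1]]] :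
      exists s t, [/\ lower k `<=` seq_union I s, upper k `<=` seq_union I t
        & seq_fdisj C D s t].
    apply: sep => // _ [z [Qz /= zk] <-] [z' [Qz' /= z'k] zz'].
    have e' := Finj Qz' Qz zz'; rewrite e' in z'k.
    by have := e0; move: zk z'k; lra.
  have /ltr_normlP[yk1 yk2] := yp k.
  have [s2 [ls2 d2]] := hbe k; have [t2 [ut2 d3]] := hal k.
  (* The cover has to refine both the one separated from [upper k] and the one formally disjoint
     from [be k]; the upper side is treated likewise. *)
  have [||a la aP] := refine_seq Ib refineP (cl k) (s := s1) (t := s2) => //.
    apply: subset_trans ls2; apply: image_subset => z [Qz /= zk]; split=> //=.
    by have := e0; move: zk yk2; lra.
  have [||c uc cP] := refine_seq Ib refineP (cu k) (s := t1) (t := t2) => //.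
    apply: subset_trans ut2; apply: image_subset => z [Qz /= zk]; split=> //=.
    by have := e0; move: zk yk1; lra.
  (* For the last coordinate of a half-cube y_k >= p_k, so [upper k] lies strictly above the bottom
     and misses [Sb]. In the other cases [t1] is a placeholder. *)
  have [t3 [ut3 d4]] : exists t3, upper k `<=` seq_union I t3 /\
     (b && is_last k -> exists2 c, Sb `<=` seq_union I c & seq_fdisj C D t3 c).
    case: (boolP (b && is_last k)) => [/andP[bT kl]|_]; last by exists t1.
    have [t [g [h1 h2 h3]]] : exists s t, [/\ upper k `<=` seq_union I s,
         Sb `<=` seq_union I t & seq_fdisj C D s t].
      apply: sep; [exact: cu|exact: cSb|move=> _ [z [Qz /= zk] <-]].
      apply: Sb2 => // k' /eqP kl'.
      have -> : k' = k by apply: val_inj; rewrite /= kl' (eqP kl).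
      have := Qy k; rewrite !mxE bT kl /= subr0 => /andP[+ _].
      by have := e0; move: zk; lra.
    by exists t; split=> // _; exists g.
  have [||c' uc' cP'] := refine_seq Ib refineP (cu k) (s := c) (t := t3) => //.
  exists (a, c'); split=> //=.
  - move=> u v /aP[[u' u's uu'] _] /cP'[[v' /cP[[v'' v''t v'v''] _] vv'] _].
    by apply: fdisjS uu' (rtc_trans vv' v'v'') (d1 _ _ _ _).
  - move=> u v /aP[_ [u' u's uu']] vb.
    by apply: fdisjS uu' (rtc_refl _ _) (d2 _ _ _ _).
  split.
    move=> u v /cP'[[u' /cP[_ [u'' u''t u'u'']] uu'] _] va.
    by apply: fdisjS (rtc_trans uu' u'u'') (rtc_refl _ _) (d3 _ _ _ _).
  move=> /d4[g Sg dg]; exists g => // u v /cP'[_ [u' u't uu']] vg.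
  by apply: fdisjS uu' (rtc_refl _ _) (dg _ _ _ _).
move=> /choice[ab abP].
pose a k := (ab k).1; pose c k := (ab k).2.
(* The head only makes the coded set nonempty: its index n+n belongs to no family, so it satisfies
   every clause trivially. *)
have [j jP] := code_of_seq hbr (cpair (n + n) 0)
  ([seq cpair (val k) q | k <- enum 'I_n, q <- a k] ++
   [seq cpair (n + val k) q | k <- enum 'I_n, q <- c k]).
have jE w : br j w -> [\/ w = cpair (n + n) 0,
    exists (k : 'I_n), exists2 q, q \in a k & w = cpair k q |
    exists (k : 'I_n), exists2 q, q \in c k & w = cpair (n + k) q].
  move=> /jP; rewrite inE mem_cat => /or3P[/eqP ->|/allpairsPdep|/allpairsPdep].
  - by constructor 1.
  - by move=> [k [q [_ qa ->]]]; constructor 2; exists k, q.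
  - by move=> [k [q [_ qa ->]]]; constructor 3; exists k, q.
have ja (k : 'I_n) q : q \in a k -> br j (cpair k q).
  move=> qa; apply/jP; rewrite inE mem_cat; apply/or3P/Or32/allpairsPdep.
  by exists k, q; rewrite mem_enum.
have jc (k : 'I_n) q : q \in c k -> br j (cpair (n + k) q).
  move=> qa; apply/jP; rewrite inE mem_cat; apply/or3P/Or33/allpairsPdep.
  by exists k, q; rewrite mem_enum.
have [m mP] := code_of_seq hbr i (sc ++
  ([seq q | k <- enum 'I_n, q <- a k] ++ [seq q | k <- enum 'I_n, q <- c k])).
exists j; split; [split|split].
- exists m; split.
    move=> x Sx; have [[q qs Iq]|nx] := pselect (seq_union I sc x).
      by exists q => //; apply/mP; rewrite inE mem_cat qs orbT.
    have [z [Qz zp] Fz] : (F @` [set z | cell (h * 2) z /\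
        forall k, `|z ord0 k - p ord0 k| < h * 2]) x.
      by apply: contrapT => nz; apply: nx; apply: hsc.
    have [zy|] := pselect (forall k, `|z ord0 k - y ord0 k| < e).
      by exists i; [apply/mP; rewrite mem_head|rewrite -Fz; exact: he].
    move=> /existsNP[k /negP]; rewrite -leNgt ler_normr => hk.
    have [la ua _ _ _] := abP k.
    have [[q qa Iq]|[q qa Iq]] : seq_union I (a k) x \/ seq_union I (c k) x.
      case/orP: hk => hk; [right; apply: ua|left; apply: la];
        by exists z => //; split=> //=; move: hk; lra.
    - exists q => //; apply/mP; rewrite inE !mem_cat.
      apply/orP; right; apply/or3P/Or32/allpairsPdep.
      by exists k, q; rewrite mem_enum.
    - exists q => //; apply/mP; rewrite inE !mem_cat.
      apply/orP; right; apply/or3P/Or33/allpairsPdep.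
      by exists k, q; rewrite mem_enum.
  move=> q /mP; rewrite inE !mem_cat => /orP[/eqP|/or3P[|/allpairsPdep|/allpairsPdep]].
  - by left.
  - by right; left.
  - move=> [k [q' [_ qa ->]]]; right; right; exists k; split; last exact: ja.
    by have := ltn_ord k; lia.
  - move=> [k [q' [_ qa ->]]]; right; right; exists (n + k)%N.
    by split; [rewrite -addnS leq_add2l ltn_ord|exact: jc].
- move=> w /jE[->|[k [q qa ->]]|[k [q qa ->]]]; rewrite !(cpairK1, cpairK2).
  + by left; exact: leq_addr.
  + move=> w' /jE[->|[k' [q' qa' ->]]|[k' [q' qa' ->]]]; rewrite !(cpairK1, cpairK2);
      right.
    * by left; have := ltn_ord k; lia.
    * by left; have := ltn_ord k'; lia.
    * have [kk'|kk'] := eqVneq k' k; last first.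
        by left => /addnI/val_inj; exact/eqP.
      by right; have [_ _ + _ _] := abP k; apply=> //; rewrite -kk'.
  + by left; exact: leq_addr.
- split=> k q qb w /jE[->|[k' [q' qa' ->]]|[k' [q' qa' ->]]];
    rewrite !(cpairK1, cpairK2); have hk := ltn_ord k.
  + by left; lia.
  + have [kk'|kk'] := eqVneq k' k; last by left => /val_inj; exact/eqP.
    by right; have [_ _ _ + _] := abP k; apply=> //; rewrite -kk'.
  + by left; lia.
  + by left; lia.
  + by left; have := ltn_ord k'; lia.
  + have [kk'|kk'] := eqVneq k' k; last by left => /addnI/val_inj; exact/eqP.
    by right; have [_ _ _ _ [+ _]] := abP k; apply=> //; rewrite -kk'.
move=> bT; have n1 : (n.-1 < n)%N by rewrite ltn_predL.
pose l := Ordinal n1.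
have ll : b && is_last l by rewrite bT /is_last eqxx.
have [_ _ _ _ [_ /(_ ll) [g Sg dg]]] := abP l.
(* The image of the centre lies in [Sb], so the cover [g] is nonempty and has a code. *)
have [x Sbx] : exists x, Sb x.
  exists (F p); apply: Sb1 => // k; rewrite !mxE.
  by have := h0; case: ifP => _; lra.
case: g Sg dg => [|g0 g] Sg dg; first by have [] := Sg _ Sbx.
have [r rP] := code_of_seq hbr g0 g; exists r; split.
  by move=> x' /Sg[q qg Iq]; exists q => //; apply/rP.
move=> w /jE[->|[k' [q' qa' ->]]|[k' [q' qa' ->]]] q /rP qg;
    rewrite !(cpairK1, cpairK2).
- by left; lia.
- by left; have := ltn_ord k'; lia.
have [kk'|kk'] := eqVneq k' l.
  by right; apply: dg => //; rewrite -kk'.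
by left => /addnI e'; move/eqP: kk'; apply; exact: val_inj.
Qed.

(** Three scales are used: points within h/2 of the centre are detected, the covering theorem is
    applied to the cell of radius h, and the chart is used up to radius 2h. The gaps make the
    relevant compact sets disjoint, hence formally separable. *)
Lemma local_ce : exists Om : nat -> Prop,
  [/\ sigma1 Om, forall i, Om i -> I i `&` S !=set0 &
    forall i y, cell (h * 2) y -> (forall k, `|y ord0 k - p ord0 k| < h / 2) ->
      I i (F y) -> Om i].
Proof.
have [sc [t [Tsc Ht dsc]]] : exists s t,
    [/\ S `\` F @` [set z | cell (h * 2) z /\
           forall k, `|z ord0 k - p ord0 k| < h * 2] `<=` seq_union I s,
        F @` (cell h `&` setT) `<=` seq_union I t & seq_fdisj C D s t].
  apply: sep => //; first exact: compact_image closedT.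
  move=> x [_ nz] [z [Qz _] zx]; apply: nz; exists z => //.
  split; first exact: cell_half.
  move=> k; apply: le_lt_trans (cell_dist k h0 Qz) _.
  by have := h0; lra.
have /choice[be beP] : forall k, exists be, (exists s,
    F @` (cell (h * 2) `&` [set z | z ord0 k <= p ord0 k + h / 2])
      `<=` seq_union I s /\ seq_fdisj C D s be) /\
    F @` (cell h `&` [set z | p ord0 k + h <= z ord0 k]) `<=` seq_union I be.
  move=> k; have [|||s [be [h1 h2 h3]]] := @sep
    (F @` (cell (h * 2) `&` [set z | z ord0 k <= p ord0 k + h / 2]))
    (F @` (cell h `&` [set z | p ord0 k + h <= z ord0 k])).
  - exact: compact_image (@closed_coord_le _ _).
  - exact: compact_image (@closed_coord_ge _ _).
  - move=> _ [z [Qz /= zk] <-] [z' [/cell_half Qz' /= z'k] zz'].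
    have e' := Finj Qz' Qz zz'; rewrite e' in z'k.
    by have := h0; move: zk z'k; lra.
  - by exists be; split=> //; exists s.
have /choice[al alP] : forall k, exists al, (exists s,
    F @` (cell (h * 2) `&` [set z | p ord0 k - h / 2 <= z ord0 k])
      `<=` seq_union I s /\ seq_fdisj C D s al) /\
    F @` (cell h `&` [set z | z ord0 k <= p ord0 k - h]) `<=` seq_union I al.
  move=> k; have [|||s [al [h1 h2 h3]]] := @sep
    (F @` (cell (h * 2) `&` [set z | p ord0 k - h / 2 <= z ord0 k]))
    (F @` (cell h `&` [set z | z ord0 k <= p ord0 k - h])).
  - exact: compact_image (@closed_coord_ge _ _).
  - exact: compact_image (@closed_coord_le _ _).
  - move=> _ [z [Qz /= zk] <-] [z' [/cell_half Qz' /= z'k] zz'].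
    have e' := Finj Qz' Qz zz'; rewrite e' in z'k.
    by have := h0; move: zk z'k; lra.
  - by exists al; split=> //; exists s.
exists (detected sc al be); split.
- exact: sigma1_detected.
- apply: detected_meets.
  + move=> z Qz [q qs Iq].
    have [q' qt Iq'] : seq_union I t (F z) by apply: Ht; exists z.
    exact: fdisjP DP CP _ _ _ (dsc _ _ qs qt) Iq Iq'.
  + by move=> k z Qz zk; have [_] := beP k; apply; exists z => //;
      split=> //=; rewrite zk.
  + by move=> k z Qz zk; have [_] := alP k; apply; exists z => //;
      split=> //=; rewrite zk.
- apply: meets_detected => // k; first by have [] := beP k.
  by have [] := alP k.
Qed.

End Local.

(** * Globalization *)

Section ChartImages.
Variables (R : realType) (n : nat) (X : topologicalType) (S : set X).
Variables (E : set 'rV[R]_n) (N : set (set_type S))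
  (phi : 'rV[R]_n -> set_type S) (gamma : set_type S -> 'rV[R]_n).
Hypothesis phiC : chart E N phi gamma.
Local Open Scope ring_scope.

Lemma nbhs_cube (q w : 'rV[R]_n) (r : R) :
  (forall k, `|w ord0 k - q ord0 k| < r) ->
  nbhs w [set z : 'rV[R]_n | forall k, `|z ord0 k - q ord0 k| < r].
Proof.
move=> hw; suff H k : \forall z \near w, `|(z : 'rV[R]_n) ord0 k - q ord0 k| < r.
  exact: filter_forall H.
apply/nbhs_rowP; exists (r - `|w ord0 k - q ord0 k|); first by rewrite subr_gt0.
move=> z /(_ k) hz; rewrite -[_ - _](subrKA (w ord0 k)).
by apply: le_lt_trans (ler_normD _ _) _; rewrite -ltrBrDr.
Qed.

(** The inverse chart is continuous at interior points of [N], so the image of an open cube is open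
    in S and is therefore the trace of an open set of [X]. *)
Lemma chart_image_open (q : 'rV[R]_n) (r : R) :
  (forall z : 'rV[R]_n, (forall k, `|z ord0 k - q ord0 k| < r) -> nbhs (phi z) N) ->
  exists2 O : set X, open O & forall x, S x ->
    (O x <-> exists z, [/\ E z, forall k, `|z ord0 k - q ord0 k| < r &
                           set_val (phi z) = x]).
Proof.
move=> hN; have [cphi NE EN cgamma] := phiC.
pose V : set (set_type S) := [set m | nbhs m N /\
  forall k, `|gamma m ord0 k - q ord0 k| < r].
have : open V.
  rewrite openE => m [Nm hm]; apply: filterI; first exact: nbhs_interior Nm.
  exact: (cgamma _ Nm [set z : 'rV[R]_n | forall k,
    `|z ord0 k - q ord0 k| < r] (nbhs_cube hm)).
move=> [G oG GV]; exists G => // x Sx.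
pose m : set_type S := exist _ x (mem_set Sx).
have -> : G x = V m by rewrite -GV.
split.
  move=> [Nm hm]; exists (gamma m).
  by have [Em mK] := NE m (nbhs_singleton Nm); split=> //; rewrite mK.
move=> [z [Ez hz zx]]; have {zx} -> : m = phi z by apply: val_inj.
by split; [exact: hN|have [_ ->] := EN _ Ez].
Qed.

End ChartImages.

(** * From charts to the whole set *)

Section Main.
Variables (R : realType) (br : nat -> set nat) (X : topologicalType)
  (I : nat -> set X) (n : nat) (C D : set (nat * nat)).
Hypotheses (hbr : finite_set_coding br) (Ib : basis (range I))
  (hC : ce_set2 C) (hD : ce_set2 D)
  (DP : forall i j, D (i, j) -> I i `&` I j = set0)
  (CP : forall i j, C (i, j) -> I i `<=` I j)
  (sepP : forall x y, x <> y -> exists i j, [/\ I i x, I j y & D (i, j)])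
  (refineP : forall x i j, (I i `&` I j) x ->
     exists k, [/\ I k x, C (k, i) & C (k, j)])
  (n0 : 0 < n).
Variables (S Sb : set X).
Hypotheses (hS : semicomputable br I S) (hSb : semicomputable br I Sb).

(** The slack between the bounds, meeting S and meeting its part in [A], makes the property pass to
    subsets and finite unions, as [compact_ind] requires. *)
Definition ce_at (A : set X) := exists Om : nat -> Prop,
  [/\ sigma1 Om, forall i, Om i -> I i `&` S !=set0 &
    forall i, (I i `&` (A `&` S)) !=set0 -> Om i].

Local Open Scope ring_scope.

Lemma chart_ce_at (b : bool) (E : set 'rV[R]_n) (N : set (set_type S)) phi gamma q :
  chart E N phi gamma -> E q -> nbhs (phi q) N ->
  (forall r : R, 0 < r -> cell b q r `<=` E) ->
  (forall (r : R) z, 0 < r -> E z -> (forall k, `|z ord0 k - q ord0 k| < r) ->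
     cell b q r z) ->
  (b -> forall z, E z -> nbhs (phi z) N ->
     (forall k, is_last k -> z ord0 k = q ord0 k) -> Sb (set_val (phi z))) ->
  (b -> forall z, E z -> nbhs (phi z) N ->
     (forall k, is_last k -> q ord0 k < z ord0 k) -> ~ Sb (set_val (phi z))) ->
  exists2 O, nbhs (set_val (phi q)) O & ce_at O.
Proof.
move=> phiC Eq Nq cellE Ecell hb1 hb2; have [cphi NE EN cgamma] := phiC.
have /nbhs_rowP[r r0 hr] : nbhs q (phi @^-1` N°).
  by apply: cphi; exact: nbhs_interior.
(* The cell of radius 2h = r/2 is then still mapped into the interior of [N]. *)
pose h := r / 4; have h0 : 0 < h by rewrite divr_gt0.
have h20 : 0 < h * 2 by rewrite mulr_gt0.
have hr2 : h * 2 < r by rewrite /h; lra.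
have hr1 : h / 2 < r by rewrite /h; lra.
have cell_near z : cell b q (h * 2) z -> forall k, `|z ord0 k - q ord0 k| < r.
  by move=> hz k; apply: le_lt_trans hr2; exact: cell_dist.
have [cS cjS] := hS; have [cSb cjSb] := hSb.
pose F z := set_val (phi z).
have cF : continuous F.
  by move=> z; apply: (@continuous_comp _ _ _ phi set_val);
    [exact: cphi|exact: initial_continuous].
have FS z : cell b q (h * 2) z -> S (F z) by move=> _; exact: set_valP.
have Finj z z' : cell b q (h * 2) z -> cell b q (h * 2) z' -> F z = F z' -> z = z'.
  move=> /(cellE _ h20) Ez /(cellE _ h20) Ez' /val_inj e.
  by have [_ <-] := EN _ Ez; have [_ <-] := EN _ Ez'; rewrite e.
have cT : compact (S `\` F @` [set z | cell b q (h * 2) z /\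
     forall k, `|z ord0 k - q ord0 k| < h * 2]).
  have [|O oO OP] := @chart_image_open R n X S E N phi gamma phiC q (h * 2).
    by move=> z hz; apply: hr => k; exact: lt_trans hr2.
  have -> : S `\` F @` [set z | cell b q (h * 2) z /\
      forall k, `|z ord0 k - q ord0 k| < h * 2] = S `&` ~` O.
    apply/seteqP; split=> x [Sx nx]; split=> //=.
      by move=> /(OP _ Sx)[z [Ez hz zx]]; apply: nx; exists z => //;
        split=> //; exact: Ecell.
    by move=> [z [Qz hz] zx]; apply: nx; apply/(OP _ Sx); exists z;
      split=> //; exact: cellE Qz.
  by apply: compact_closedI => //; exact: open_closedC.
have [||Om [sOm OmS OmP]] := @local_ce R br X I n C D hbr Ib hC hD DP CP sepP refineP
    n0 S Sb b cjS (fun=> cSb) (fun=> cjSb) F q h cF h0 FS Finj cT.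
- by move=> bT z Qz; apply: hb1 => //; [exact: cellE Qz|apply: hr; exact: cell_near].
- by move=> bT z Qz; apply: hb2 => //; [exact: cellE Qz|apply: hr; exact: cell_near].
have [|O oO OP] := @chart_image_open R n X S E N phi gamma phiC q (h / 2).
  by move=> z hz; apply: hr => k; exact: lt_trans hr1.
exists O.
  apply: open_nbhs_nbhs; split=> //; apply/OP; first exact: set_valP.
  by exists q; split=> // k; rewrite subrr normr0 divr_gt0.
exists Om; split=> // i [x [Ix [Ox Sx]]].
have /(OP _ Sx)[z [Ez hz zx]] := Ox.
apply: (OmP i z) => //; last by rewrite /F zx.
by apply: Ecell => // k; apply: lt_trans (hz k) _; lra.
Qed.

End Main.

Theorem theorem7p3 (R : realType) (br : nat -> set nat)
  (X : topologicalType) (I : nat -> set X) (n : nat) (S : set X)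
  (hbr : finite_set_coding br)
  (hX : computable_space I)
  (hn : 0 < n)
  (hS : semicomputable br I S)
  (hM : manifold_with_boundary R n (set_type S))
  (hbd : semicomputable br I (set_val @` manifold_boundary R n (set_type S))) :
  computable_compact br I S.
Proof.
have [Ib [C [D [hC hD [DP CP sepP refineP]]]]] := hX.
have [cS _] := hS.
have clS : closed S.
  by apply: compact_closed => //; exact: computable_space_hausdorff Ib DP sepP.
split=> //; split=> //.
(* For [A] equal to S the two bounds coincide and the predicate is exactly that of meeting S. *)
suff : ce_at I S S.
  move=> [Om [sOm OmS OmP]]; apply: sigma1_ce; apply: sigma1_ext sOm => i.
  split=> [/OmS //|[x [Ix Sx]]]; apply: OmP; by exists x.
apply: (compact_ind cS).
- exists (fun=> False); split=> //; first exact: sigma1_false.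
  by move=> i [x [_ []]].
- move=> A B [P [sP PS PA]] [Q [sQ QS QB]].
  exists (fun i => P i \/ Q i); split.
  + exact: sigma1_or.
  + by move=> i [/PS|/QS].
  + by move=> i [x [Ix [[Ax|Bx] Sx]]]; [left; apply: PA|right; apply: QB]; exists x.
- move=> A B AB [P [sP PS PB]]; exists P; split=> // i [x [Ix [/AB Bx Sx]]].
  by apply: PB; exists x.
move=> x Sx; pose m : set_type S := exist _ x (mem_set Sx).
have ce_chart := chart_ce_at hbr Ib hC hD DP CP sepP refineP hn hS hbd.
have [[N [Nm [f hf]]]|[N [Nm [f [hf [p [p0 fp]]]]]]] := hM m.
  have [gamma phiC] := @chart_of_homeomorphism R n (set_type S) _ N id id f
    (fun z => cvg_id) (fun z => cvg_id) (fun=> erefl) hf.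
  have fullE z : range (id : 'rV[R]_n -> 'rV[R]_n) z by exists z.
  pose q : 'rV[R]_n := (let: exist g _ := cid hf.2 in g)
    (exist _ m (mem_set (nbhs_singleton Nm))).
  have phiq : set_val (f q) = m.
    by rewrite /q; case: cid => g [_ /= -> _].
  have [||||||O xO cO] := ce_chart R false _ N _ gamma q phiC => //.
  - by rewrite phiq.
  - by move=> r _ z _; exact: fullE.
  - move=> r z r0 _ hz k; rewrite !mxE /=; have := hz k.
    by rewrite ltr_norml => /andP[]; lra.
  by exists O => //; rewrite phiq in xO.
have [phi [gamma [phiC phiE]]] := half_space_chart hf.
pose q : 'rV[R]_n := set_val p.
have phiq : phi q = m by rewrite phiE.
have Eq : half_space R n q by exact: set_valP.
have n1 : (n.-1 < n)%N by rewrite ltn_predL.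
have qlast i : is_last i -> q ord0 i = 0%R by move=> /eqP; exact: p0.
have [|||||O xO cO] := ce_chart R true _ N phi gamma q phiC Eq => //.
- by rewrite phiq.
- move=> r r0 z hz i il; have := hz i.
  by rewrite !mxE /is_last il eqxx /= -/q qlast ?subr0 => [/andP[]|];
    rewrite // /is_last il.
- move=> r z r0 Ez hz k; have := hz k; rewrite !mxE ltr_norml => /andP[h1 h2].
  case: ifP => /= kl; last by apply/andP; split; lra.
  rewrite subr0 qlast // Ez; last exact/eqP.
  by move: h2; rewrite qlast //; lra.
(* The same half-space chart shows that its bottom points are boundary points. *)
- move=> _ z Ez Nz zl; exists (phi z) => //; exists N; split=> //.
  exists f; split=> //; exists (exist _ z (mem_set Ez)); split.
    by move=> i /eqP il /=; rewrite zl // qlast.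
  by rewrite -phiE.
(* A half-space chart centred at a point above the bottom is excluded by [boundary_invariance]. *)
- move=> _ z Ez Nz zl [m' + /val_inj e]; rewrite e.
  move=> [N' [Nm' [f' [hf' [p' [p'0 fp']]]]]].
  have [phi' [gamma' [phiC' phiE']]] := half_space_chart hf'.
  apply: (boundary_invariance hn phiC Nz _ phiC' Nm' p'0).
    by move=> i il; rewrite -(qlast i il); exact: zl.
  by rewrite phiE'.
by exists O => //; rewrite phiq in xO.
Qed.
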